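(* If $\mu\in\mathcal{M}$ is not a point mass and $\mathrm{Ind}(\mu)>0$, then for every $q>0$ the measures $(\mu^{\uplus q})^{\mathrm{ac}}$ and $\mu^{\mathrm{ac}}$ have the same number of components in their supports.
   Context: $\mathcal{M}$ is the set of Borel probability measures on $\mathbb{R}$ and $\mathbb{C}^+$ is the open upper half-plane. For $\mu\in\mathcal{M}$: $G_\mu(z)=\int_{\mathbb{R}}\frac{d\mu(s)}{z-s}$, $F_\mu=1/G_\mu$, $E_\mu(z)=z-F_\mu(z)$ for $z\in\mathbb{C}^+$; $F_\mu$ has a right inverse $F_\mu^{-1}$ on some truncated cone $\Gamma_{\alpha,\beta}=\{x+iy:|x|\le\alpha y,\ y\ge\beta\}$, and $\phi_\mu(z)=F_\mu^{-1}(z)-z$ there. For $p\ge1$, $\mu^{\boxplus p}\in\mathcal{M}$ is the unique measure with $\phi_{\mu^{\boxplus p}}=p\,\phi_\mu$ on some truncated cone (it always exists). For $q\ge0$, $\mu^{\uplus q}\in\mathcal{M}$ is the unique measure with $E_{\mu^{\uplus q}}=qE_\mu$. For $t\ge0$, $\mathbb{B}_t(\mu)=\left(\mu^{\boxplus(t+1)}\right)^{\uplus\frac{1}{t+1}}$, and $\mathrm{Ind}(\mu)=\sup\{t\ge0:\mu\in\mathbb{B}_t(\mathcal{M})\}\in[0,\infty]$. $\nu^{\mathrm{ac}}$ is the absolutely continuous part of $\nu$ with respect to Lebesgue measure; the number of components of a support is the number (possibly infinite) of its connected components. *)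

(* Defs.v *)
(* MathComp-Analysis over an abstract [R : realType]; complex numbers are
   [R[i]] from mathcomp-real-closed. *)
From HB Require Import structures.
From mathcomp Require Import all_boot all_order all_algebra.
From mathcomp Require Import all_classical all_reals all_analysis.
From mathcomp.real_closed Require Import complex.
Set Implicit Arguments.
Unset Strict Implicit.
Unset Printing Implicit Defensive.
Import Order.TTheory GRing.Theory Num.Theory numFieldNormedType.Exports.
Local Open Scope classical_set_scope.
Local Open Scope ring_scope.
Local Open Scope complex_scope.

Section definitions.
Context {R : realType}.
Implicit Types (mu nu rho : probability (measurableTypeR R) R) (z : R[i]).

Definition upper_half_plane : set R[i] := [set z | 0 < complex.Im z].

(* Only used for [z] in the upper half-plane, where the integrand is bounded. *)
Definition cauchy_transform mu z : R[i] :=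
  (\int[mu]_s complex.Re (z - s%:C)^-1) +i*
  (\int[mu]_s complex.Im (z - s%:C)^-1).

Definition F_transform mu z : R[i] := (cauchy_transform mu z)^-1.

Definition E_transform mu z : R[i] := z - F_transform mu z.

Definition truncated_cone (a b : R) : set R[i] :=
  [set z | `|complex.Re z| <= a * complex.Im z /\ b <= complex.Im z].

(* [G] is a right inverse of [F_transform mu] on [truncated_cone a b]. The
   equation [F (G z) = z] alone does not single out a branch: for
   [F z = z - 1 / z], both [w] and [- 1 / w] solve [F w = z] in the upper
   half-plane. The inverse branch meant in free probability is the one obtained
   from the injectivity of [F] on truncated cones; asking that [G] take its
   values in some truncated cone forces [G z / z --> 1] at infinity, and so
   determines [G] far enough in the cone. *)
Definition is_F_inverse mu (a b : R) (G : R[i] -> R[i]) : Prop :=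
  (exists a' b' : R, [/\ 0 < a', 0 < b' &
    forall z, truncated_cone a b z -> truncated_cone a' b' (G z)]) /\
  (forall z, truncated_cone a b z -> F_transform mu (G z) = z).

(* [phi] is the Voiculescu transform of [mu] on [truncated_cone a b]. *)
Definition is_voiculescu_transform mu (a b : R) (phi : R[i] -> R[i]) : Prop :=
  exists2 G, is_F_inverse mu a b G &
    forall z, truncated_cone a b z -> phi z = G z - z.

(* [nu] is the free convolution power of [mu] of exponent [p]. The convolution
   powers, and hence the map B_t, are given by their graphs: they are defined as
   the unique probability measure with the stated property. *)
Definition is_free_power (p : R) mu nu : Prop :=
  exists a b : R, [/\ 0 < a, 0 < b &
    exists phi_mu phi_nu : R[i] -> R[i],
      [/\ is_voiculescu_transform mu a b phi_mu,
          is_voiculescu_transform nu a b phi_nu &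
          forall z, truncated_cone a b z -> phi_nu z = p%:C * phi_mu z]].

(* [nu] is the Boolean convolution power of [mu] of exponent [q]. *)
Definition is_boolean_power (q : R) mu nu : Prop :=
  forall z, upper_half_plane z -> E_transform nu z = q%:C * E_transform mu z.

(* [nu] is the image of [mu] under the map B_t. *)
Definition is_B (t : R) mu nu : Prop :=
  exists2 rho, is_free_power (t + 1) mu rho &
               is_boolean_power (t + 1)^-1 rho nu.

Definition Ind mu : \bar R :=
  ereal_sup [set t%:E | t in [set t : R | 0 <= t /\ exists nu, is_B t nu mu]].

Definition point_mass mu : Prop :=
  exists a : R, forall A, measurable A -> mu A = \d_a A.

Definition singular (nu : {measure set (measurableTypeR R) -> \bar R}) : Prop :=
  exists N : set (measurableTypeR R),
    [/\ measurable N, lebesgue_measure N = 0%E & nu (~` N) = 0%E].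

(* [nu] is the absolutely continuous part of [mu] in its Lebesgue decomposition
   with respect to Lebesgue measure. *)
Definition is_ac_part mu (nu : {measure set (measurableTypeR R) -> \bar R}) :
    Prop :=
  nu `<< (@lebesgue_measure R) /\
  exists2 sigma : {measure set (measurableTypeR R) -> \bar R}, singular sigma &
    forall A, measurable A -> mu A = (nu A + sigma A)%E.

Definition measure_support
    (nu : {measure set (measurableTypeR R) -> \bar R}) : set R :=
  [set x : R | forall U : set R, open_nbhs x U -> (0 < nu U)%E].

(* Number of connected components, in {0, 1, 2, ...} U {+oo}. *)
Definition number_of_components (S : set R) : \bar R :=
  counting [set connected_component S x | x in S].

End definitions.

(* Main.v *)
Require Import Defs.
From HB Require Import structures.
From mathcomp Require Import all_boot all_order all_algebra.
From mathcomp Require Import all_classical all_reals all_analysis.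
From mathcomp.real_closed Require Import complex.
From mathcomp Require Import measurable_realfun.
From mathcomp Require Import ring lra.
Import Order.TTheory GRing.Theory Num.Theory numFieldNormedType.Exports.
Local Open Scope classical_set_scope.
Local Open Scope ring_scope.

(** The two supports are equal, because the absolutely continuous parts of [mu]
    and [mu_q] have the same null sets.

    Write [G] for the Cauchy transform and [F = 1 / G].  In terms of [F] the
    Boolean power reads [F_q z = q * F z + (1 - q) * z], so that [Im F_q] and
    [q * Im F] have the same limits on the real axis.  At almost every real
    point the density of the absolutely continuous part is the boundary value
    of [- Im G / pi = Im F / (pi * |F|^2)].  As long as [F] and [F_q] have finite
    nonzero boundary values, one density therefore vanishes exactly where the
    other one does.  This is the invariance of the absolutely continuous
    spectrum under rank one perturbations.

    The proof replaces boundary values by estimates on horizontal lines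
    [Im z = y] that survive as [y] tends to [0].  Suppose that the absolutely
    continuous part of [mu_q] charges a set which that of [mu] does not charge.
    Then some compact [K] has positive Lebesgue measure, [mu K = 0], and
    [mu_q >= eta * Lebesgue] on [K] ([density_on_compact]).
    - The Poisson integral [- Im G] of [mu] tends to [0] in L^1 on [K]
      ([poisson_off_compact]).
    - The Poisson integral of [mu_q] is at least [eta / 2] at the points of [K]
      where the Poisson integral of Lebesgue measure near but off [K] is at most
      [1/2] ([poisson_int_density]); that last integral also tends to [0] in L^1
      on [K].
    - The points of [K] where [|G_q| >= 1 / c] have measure [O(c)], uniformly in
      [y].  Indeed [c * Im (- 1 / (F_q + i c))] lies in [[0, 1]], is at least
      [1/2] at these points, and has integral at most [3 * pi * c]
      ([integral_damped_im_le]).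
    At each point of [K], either [c * Im (- 1 / (F_q + i c)) >= 1/2], or the
    Poisson integral of Lebesgue measure off [K] is at least [1/2], or [- Im G]
    is at least a positive constant that does not depend on [y]
    ([boolean_power_dichotomy]).  Integrating over [K] and letting [y] tend to
    [0] bounds the measure of [K] by [6 * pi * c]; as [c] is arbitrary, it is
    zero ([boolean_power_null]).

    The weak type bound is the only place where analyticity matters.  The
    function [- 1 / (F_q + i c)] is analytic and decays at infinity, so its
    integral over a long horizontal segment hardly depends on the height of the
    segment; and at height [y + c] its imaginary part is at most [- 2 * Im G_q],
    whose integral is at most [2 * pi]. *)

Set Implicit Arguments.
Unset Strict Implicit.
Unset Printing Implicit Defensive.

(** * Derivatives of quotients and squares *)

Section calculus.
Context {R : realType}.
Implicit Types (f g : R -> R) (x t y : R).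

Lemma is_derive_div f g x df dg :
  is_derive x 1 f df -> is_derive x 1 g dg -> g x != 0 ->
  is_derive x 1 (fun u => f u / g u) ((df * g x - f x * dg) / g x ^+ 2).
Proof.
move=> hf hg gx0.
have h := is_deriveM hf (is_deriveV gx0 hg).
apply: (@is_derive_eq _ _ _ _ _ _ _ _ h).
by rewrite /GRing.scale/=; field.
Qed.

Lemma is_derive_sqr f x df : is_derive x 1 f df ->
  is_derive x 1 (fun u => f u ^+ 2) (2 * f x * df).
Proof.
move=> hf; have h := is_deriveM hf hf.
apply: (@is_derive_eq _ _ _ _ _ _ _ _ h).
by rewrite /GRing.scale/=; ring.
Qed.

Lemma is_derive_sub s x : is_derive x 1 (fun u => s - u) (- 1 : R).
Proof.
have h := is_deriveB (is_derive_cst s x 1) (is_derive_id x 1).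
by apply: (@is_derive_eq _ _ _ _ _ _ _ _ h); rewrite sub0r.
Qed.

End calculus.

(** * The Poisson kernel and its conjugate *)

Section kernels.
Context {R : realType}.
Implicit Types x t y s d : R.

(** These are the imaginary part, then the real part, of [1 / (t - i y)]; with
    [t = s - x] they integrate to the two parts of [- G (x + i y)]. *)
Definition poisson y t : R := y / (t ^+ 2 + y ^+ 2).
Definition conj_poisson y t : R := t / (t ^+ 2 + y ^+ 2).
(** The two parts of [1 / (t - i y)^2], the complex derivative of
    [1 / (s - z)] in [z]: all four partial derivatives below are expressed by
    them, which is the Cauchy-Riemann system. *)
Definition re_inv_sqr y t : R := (t ^+ 2 - y ^+ 2) / (t ^+ 2 + y ^+ 2) ^+ 2.
Definition im_inv_sqr y t : R := (2 * t * y) / (t ^+ 2 + y ^+ 2) ^+ 2.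

Lemma sqr_norm_gt0 y t : 0 < y -> 0 < t ^+ 2 + y ^+ 2.
Proof. by move=> y0; rewrite ltr_wpDl ?sqr_ge0// exprn_gt0. Qed.

Lemma sqr_norm_neq0 y t : 0 < y -> t ^+ 2 + y ^+ 2 != 0.
Proof. by move=> y0; rewrite gt_eqF// sqr_norm_gt0. Qed.

Lemma is_derive_sqr_norm1 s x y :
  is_derive x 1 (fun u => (s - u) ^+ 2 + y ^+ 2) (- (2 * (s - x))).
Proof.
have h := is_deriveD (is_derive_sqr (is_derive_sub s x)) (is_derive_cst (y ^+ 2) x 1).
by apply: (@is_derive_eq _ _ _ _ _ _ _ _ h); ring.
Qed.

Lemma is_derive_sqr_norm2 t y :
  is_derive y 1 (fun v => t ^+ 2 + v ^+ 2) (2 * y).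
Proof.
have h := is_deriveD (is_derive_cst (t ^+ 2) y 1) (is_derive_sqr (is_derive_id y 1)).
by apply: (@is_derive_eq _ _ _ _ _ _ _ _ h); ring.
Qed.

Lemma is_derive_conj_poisson1 s x y : 0 < y ->
  is_derive x 1 (fun u => conj_poisson y (s - u)) (re_inv_sqr y (s - x)).
Proof.
move=> y0; have h := is_derive_div (is_derive_sub s x)
  (is_derive_sqr_norm1 s x y) (sqr_norm_neq0 (s - x) y0).
apply: (@is_derive_eq _ _ _ _ _ _ _ _ h).
rewrite /re_inv_sqr /=; congr (_ * _); ring.
Qed.

Lemma is_derive_poisson1 s x y : 0 < y ->
  is_derive x 1 (fun u => poisson y (s - u)) (im_inv_sqr y (s - x)).
Proof.
move=> y0; have h := is_derive_div (is_derive_cst y x 1)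
  (is_derive_sqr_norm1 s x y) (sqr_norm_neq0 (s - x) y0).
apply: (@is_derive_eq _ _ _ _ _ _ _ _ h).
rewrite /im_inv_sqr /=; congr (_ * _); rewrite /cst; ring.
Qed.

Lemma is_derive_conj_poisson2 t y : 0 < y ->
  is_derive y 1 (conj_poisson ^~ t) (- im_inv_sqr y t).
Proof.
move=> y0; have h := is_derive_div (is_derive_cst t y 1)
  (is_derive_sqr_norm2 t y) (sqr_norm_neq0 t y0).
apply: (@is_derive_eq _ _ _ _ _ _ _ _ h).
rewrite /im_inv_sqr /= -[RHS]mulNr; congr (_ * _); rewrite /cst; ring.
Qed.

Lemma is_derive_poisson2 t y : 0 < y ->
  is_derive y 1 (poisson ^~ t) (re_inv_sqr y t).
Proof.
move=> y0; have h := is_derive_div (is_derive_id y 1)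
  (is_derive_sqr_norm2 t y) (sqr_norm_neq0 t y0).
apply: (@is_derive_eq _ _ _ _ _ _ _ _ h).
rewrite /re_inv_sqr /=; congr (_ * _); ring.
Qed.

Lemma poisson_ge0 y t : 0 < y -> 0 <= poisson y t.
Proof. by move=> y0; rewrite divr_ge0 ?ltW ?sqr_norm_gt0. Qed.

Lemma poisson_le d y t : 0 < d -> d <= y -> `|poisson y t| <= d^-1.
Proof.
move=> d0 dy; have y0 : 0 < y by exact: lt_le_trans dy.
rewrite ger0_norm ?poisson_ge0// /poisson ler_pdivrMr ?sqr_norm_gt0// ler_pdivlMl//.
have := sqr_ge0 t; nra.
Qed.

Lemma conj_poisson_le d y t : 0 < d -> d <= y -> `|conj_poisson y t| <= d^-1.
Proof.
move=> d0 dy; have y0 : 0 < y by exact: lt_le_trans dy.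
rewrite /conj_poisson normrM normfV (gtr0_norm (sqr_norm_gt0 t y0)).
rewrite ler_pdivrMr ?sqr_norm_gt0// ler_pdivlMl//.
rewrite -[t ^+ 2]real_normK ?num_real//.
have := sqr_ge0 (`|t| - y); have := normr_ge0 t; nra.
Qed.

Lemma re_inv_sqr_le d y t : 0 < d -> d <= y -> `|re_inv_sqr y t| <= (d ^+ 2)^-1.
Proof.
move=> d0 dy; have y0 : 0 < y by exact: lt_le_trans dy.
rewrite /re_inv_sqr normrM normfV normrX (gtr0_norm (sqr_norm_gt0 t y0)).
have p0 := sqr_norm_gt0 t y0.
have h : `|t ^+ 2 - y ^+ 2| <= t ^+ 2 + y ^+ 2.
  by rewrite ler_norml; have := sqr_ge0 t; have := sqr_ge0 y; lra.
rewrite ler_pdivrMr ?exprn_gt0// ler_pdivlMl ?exprn_gt0//.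
have hd : d ^+ 2 <= t ^+ 2 + y ^+ 2 by have := sqr_ge0 t; nra.
rewrite [leRHS]expr2; apply: ler_pM => //; exact: sqr_ge0.
Qed.

Lemma im_inv_sqr_le d y t : 0 < d -> d <= y -> `|im_inv_sqr y t| <= (d ^+ 2)^-1.
Proof.
move=> d0 dy; have y0 : 0 < y by exact: lt_le_trans dy.
rewrite /im_inv_sqr normrM normfV normrX (gtr0_norm (sqr_norm_gt0 t y0)).
have p0 := sqr_norm_gt0 t y0.
have h : `|2 * t * y| <= t ^+ 2 + y ^+ 2.
  by rewrite ler_norml; have := sqr_ge0 (t + y); have := sqr_ge0 (t - y); nra.
rewrite ler_pdivrMr ?exprn_gt0// ler_pdivlMl ?exprn_gt0//.
have hd : d ^+ 2 <= t ^+ 2 + y ^+ 2 by have := sqr_ge0 t; nra.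
rewrite [leRHS]expr2; apply: ler_pM => //; exact: sqr_ge0.
Qed.

Lemma continuous_sqr_norm y : continuous (fun t => t ^+ 2 + y ^+ 2 : R).
Proof.
move=> t; apply: cvgD; last exact: cvg_cst.
exact: exprn_continuous.
Qed.

Lemma continuous_poisson y : 0 < y -> continuous (poisson y).
Proof.
move=> y0 t; apply: cvgM; first exact: cvg_cst.
by apply: cvgV; [exact: sqr_norm_neq0|exact: continuous_sqr_norm].
Qed.

Lemma continuous_conj_poisson y : 0 < y -> continuous (conj_poisson y).
Proof.
move=> y0 t; apply: cvgM; first exact: cvg_id.
by apply: cvgV; [exact: sqr_norm_neq0|exact: continuous_sqr_norm].
Qed.

Lemma continuous_re_inv_sqr y : 0 < y -> continuous (re_inv_sqr y).
Proof.
move=> y0 t; apply: cvgM.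
  by apply: cvgB; [exact: exprn_continuous|exact: cvg_cst].
apply: cvgV; first by rewrite expf_neq0// sqr_norm_neq0.
by rewrite expr2; apply: cvgM; exact: continuous_sqr_norm.
Qed.

Lemma continuous_im_inv_sqr y : 0 < y -> continuous (im_inv_sqr y).
Proof.
move=> y0 t; apply: cvgM.
  apply: cvgM; last exact: cvg_cst.
  by apply: cvgM; [exact: cvg_cst|exact: cvg_id].
apply: cvgV; first by rewrite expf_neq0// sqr_norm_neq0.
by rewrite expr2; apply: cvgM; exact: continuous_sqr_norm.
Qed.

Lemma continuous_subl (k : R -> R) s : continuous k -> continuous (fun x => k (s - x)).
Proof.
move=> ck x; apply: continuous_comp; last exact: ck.
by apply: cvgB; [exact: cvg_cst|exact: cvg_id].
Qed.

Lemma continuous_subr (k : R -> R) x : continuous k -> continuous (fun s => k (s - x)).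
Proof.
move=> ck s; apply: continuous_comp; last exact: ck.
by apply: cvgB; [exact: cvg_id|exact: cvg_cst].
Qed.

End kernels.

(** * Differentiation and continuity under the integral sign *)

Section under_integral.
Context {R : realType}.
Variables (m : {measure set (measurableTypeR R) -> \bar R}).
Variables (D : set (measurableTypeR R)).
Hypotheses (mD : measurable D) (Dfin : (m D < +oo)%E).

Lemma integrable_bounded (k : R -> R) (C : R) :
  measurable_fun D k -> (forall s, `|k s| <= C) ->
  m.-integrable D (EFin \o k).
Proof.
move=> mk kC; apply: measurable_bounded_integrable => //.
exists C; split; first exact: num_real.
by move=> M CM s _ /=; rewrite (le_trans (kC s))// ltW.
Qed.

(** The bound [C] on the derivative is its own integrable majorant, because [D]
    has finite measure. *)
Lemma is_derive_under (k k' : R -> R -> R) (u v a C : R) :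
  u < a < v ->
  (forall x, u < x < v -> m.-integrable D (EFin \o k x)) ->
  (forall x s, u < x < v -> is_derive x 1 (k ^~ s) (k' x s)) ->
  (forall x s, u < x < v -> `|k' x s| <= C) ->
  is_derive a 1 (fun x => \int[m]_(s in D) k x s) (\int[m]_(s in D) k' a s).
Proof.
move=> uav intk dk k'C.
have C0 : 0 <= C by exact: le_trans (k'C a 0 uav).
have E x s : u < x < v -> partial1of2 k x s = k' x s.
  by move=> uxv; rewrite partial1of2E; have [_ ->] := dk x s uxv.
have Ia : `]u, v[%classic a by rewrite /= in_itv.
have Hk x : `]u, v[%classic x -> m.-integrable D (EFin \o k x).
  by rewrite /= in_itv => /intk.
have Hd x s : `]u, v[%classic x -> D s -> derivable (k ^~ s) x 1.
  by rewrite /= in_itv => /(dk x s) [].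
have HC x s : `]u, v[%classic x -> D s -> `|partial1of2 k x s| <= cst C s.
  by rewrite /= in_itv => xuv _; rewrite E// k'C.
have intC : m.-integrable D (EFin \o (cst C : R -> R)).
  by apply: (@integrable_bounded _ `|C|) => //.
have C0' (s : measurableTypeR R) : 0 <= cst C s by [].
have dv := derivable_under_integral mD Ia Hk Hd C0' intC HC.
have de := differentiation_under_integral mD Ia Hk Hd C0' intC HC.
apply: DeriveDef => //; rewrite -derive1E de.
by apply: eq_Rintegral => s _; rewrite -E.
Qed.

Lemma continuous_under (k : R -> R -> R) (C : R) :
  (forall x, measurable_fun D (k x)) ->
  (forall x s, `|k x s| <= C) -> (forall s, continuous (k ^~ s)) ->
  continuous (fun x => \int[m]_(s in D) k x s).
Proof.
move=> mk kC ck x.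
apply: (@continuity_under_integral R _ _ m k D mD (x - 1) (x + 1) _ _ (cst C)).
- by move=> y _; apply: integrable_bounded.
- by apply: aeW => s _ y _; exact: ck.
- by apply: (@integrable_bounded _ `|C|) => //.
- by move=> y _; apply: aeW => s _; exact: kC.
- by rewrite inE/= in_itv/=; lra.
Qed.

End under_integral.

(** * Real and imaginary parts of the Cauchy transform *)

Section cauchy_parts.
Context {R : realType}.
Variable m : probability (measurableTypeR R) R.
Implicit Types x y d : R.

(** [conj_int] and [poisson_int] are minus the real and imaginary parts of the
    Cauchy transform at [x + i y]; the other two are the parts of minus its
    complex derivative. *)
Definition poisson_int x y : R := \int[m]_s poisson y (s - x).
Definition conj_int x y : R := \int[m]_s conj_poisson y (s - x).
Definition re_inv_sqr_int x y : R := \int[m]_s re_inv_sqr y (s - x).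
Definition im_inv_sqr_int x y : R := \int[m]_s im_inv_sqr y (s - x).

Lemma probability_fin : (m setT < +oo)%E.
Proof. by rewrite probability_setT ltry. Qed.

Lemma integrable_translate (k : R -> R) (C : R) x :
  continuous k -> (forall t, `|k t| <= C) ->
  m.-integrable setT (EFin \o (fun s => k (s - x))).
Proof.
move=> ck kC; apply: (integrable_bounded _ probability_fin (C := C)) => //.
by apply: continuous_measurable_fun; exact: continuous_subr.
Qed.

Lemma integrable_poisson x y : 0 < y ->
  m.-integrable setT (EFin \o (fun s => poisson y (s - x))).
Proof.
move=> y0; apply: (integrable_translate (C := y^-1)).
  exact: continuous_poisson.
by move=> t; exact: poisson_le.
Qed.

Lemma integrable_conj_poisson x y : 0 < y ->
  m.-integrable setT (EFin \o (fun s => conj_poisson y (s - x))).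
Proof.
move=> y0; apply: (integrable_translate (C := y^-1)).
  exact: continuous_conj_poisson.
by move=> t; exact: conj_poisson_le.
Qed.

Lemma is_derive_conj_int1 x y : 0 < y ->
  is_derive x 1 (conj_int ^~ y) (re_inv_sqr_int x y).
Proof.
move=> y0; apply: (@is_derive_under _ _ _ measurableT probability_fin
  (fun x s => conj_poisson y (s - x)) (fun x s => re_inv_sqr y (s - x))
  (x - 1) (x + 1) x (y ^+ 2)^-1).
- lra.
- by move=> *; exact: integrable_conj_poisson.
- by move=> *; exact: is_derive_conj_poisson1.
- by move=> *; exact: re_inv_sqr_le.
Qed.

Lemma is_derive_poisson_int1 x y : 0 < y ->
  is_derive x 1 (poisson_int ^~ y) (im_inv_sqr_int x y).
Proof.
move=> y0; apply: (@is_derive_under _ _ _ measurableT probability_fin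
  (fun x s => poisson y (s - x)) (fun x s => im_inv_sqr y (s - x))
  (x - 1) (x + 1) x (y ^+ 2)^-1).
- lra.
- by move=> *; exact: integrable_poisson.
- by move=> *; exact: is_derive_poisson1.
- by move=> *; exact: im_inv_sqr_le.
Qed.

Lemma is_derive_conj_int2 x y : 0 < y ->
  is_derive y 1 (conj_int x) (- im_inv_sqr_int x y).
Proof.
move=> y0.
have -> : - im_inv_sqr_int x y = \int[m]_s - im_inv_sqr y (s - x).
  rewrite -mulN1r -RintegralZl//; first by apply: eq_Rintegral => s _; rewrite mulN1r.
  apply: (integrable_translate (C := (y ^+ 2)^-1)).
    exact: continuous_im_inv_sqr.
  by move=> t; exact: im_inv_sqr_le.
have y20 : 0 < y / 2 by rewrite divr_gt0.
apply: (@is_derive_under _ _ _ measurableT probability_fin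
  (fun y s => conj_poisson y (s - x)) (fun y s => - im_inv_sqr y (s - x))
  (y / 2) (y + 1) y ((y / 2) ^+ 2)^-1).
- lra.
- by move=> v hv; apply: integrable_conj_poisson; lra.
- by move=> v s hv; apply: is_derive_conj_poisson2; lra.
- by move=> v s hv; rewrite normrN im_inv_sqr_le//; lra.
Qed.

Lemma is_derive_poisson_int2 x y : 0 < y ->
  is_derive y 1 (poisson_int x) (re_inv_sqr_int x y).
Proof.
move=> y0.
have y20 : 0 < y / 2 by rewrite divr_gt0.
apply: (@is_derive_under _ _ _ measurableT probability_fin
  (fun y s => poisson y (s - x)) (fun y s => re_inv_sqr y (s - x))
  (y / 2) (y + 1) y ((y / 2) ^+ 2)^-1).
- lra.
- by move=> v hv; apply: integrable_poisson; lra.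
- by move=> v s hv; apply: is_derive_poisson2; lra.
- by move=> v s hv; rewrite re_inv_sqr_le//; lra.
Qed.

Lemma continuous_translate_int (k : R -> R) (C : R) :
  continuous k -> (forall t, `|k t| <= C) ->
  continuous (fun x => \int[m]_s k (s - x)).
Proof.
move=> ck kC.
apply: (continuous_under measurableT probability_fin (C := C)
  (k := fun x s => k (s - x))) => //.
- by move=> x; apply: continuous_measurable_fun; exact: continuous_subr.
- by move=> s; exact: continuous_subl.
Qed.

Lemma continuous_poisson_int y : 0 < y -> continuous (poisson_int ^~ y).
Proof.
move=> y0; apply: (continuous_translate_int (C := y^-1)).
  exact: continuous_poisson.
by move=> t; exact: poisson_le.
Qed.

Lemma continuous_conj_int y : 0 < y -> continuous (conj_int ^~ y).
Proof.
move=> y0; apply: (continuous_translate_int (C := y^-1)).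
  exact: continuous_conj_poisson.
by move=> t; exact: conj_poisson_le.
Qed.

Lemma continuous_re_inv_sqr_int y : 0 < y -> continuous (re_inv_sqr_int ^~ y).
Proof.
move=> y0; apply: (continuous_translate_int (C := (y ^+ 2)^-1)).
  exact: continuous_re_inv_sqr.
by move=> t; exact: re_inv_sqr_le.
Qed.

Lemma continuous_im_inv_sqr_int y : 0 < y -> continuous (im_inv_sqr_int ^~ y).
Proof.
move=> y0; apply: (continuous_translate_int (C := (y ^+ 2)^-1)).
  exact: continuous_im_inv_sqr.
by move=> t; exact: im_inv_sqr_le.
Qed.

Lemma norm_int_le (k : R -> R) (C : R) : continuous k ->
  (forall t, `|k t| <= C) -> `|\int[m]_s k s| <= C.
Proof.
move=> ck kC.
have ik : m.-integrable setT (EFin \o k).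
  have := integrable_translate 0 ck kC.
  by under eq_fun do rewrite subr0.
apply: (le_trans (le_normr_Rintegral measurableT ik)).
have -> : C = \int[m]_s (cst C s).
  by rewrite Rintegral_cst//= probability_setT/= mulr1.
apply: le_Rintegral => //.
- exact: integrable_norm.
- by apply: (integrable_bounded _ probability_fin (C := `|C|)) => //.
Qed.

Lemma poisson_int_ge0 x y : 0 < y -> 0 <= poisson_int x y.
Proof. by move=> y0; apply: Rintegral_ge0 => s _; exact: poisson_ge0. Qed.

End cauchy_parts.

(** * Exchanging the order of integration for the Poisson kernel *)

Section tonelli.
Context {R : realType}.
Notation lam := (@lebesgue_measure R).
Implicit Types (x y s a b : R) (K D : set (measurableTypeR R)).

(** An antiderivative is [x |-> - atan ((s - x) / y)]. *)
Lemma integral_poisson_itv y s a b : 0 < y -> a < b ->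
  (\int[lam]_(x in `[a, b]) (poisson y (s - x))%:E =
   (atan ((s - a) / y) - atan ((s - b) / y))%:E)%E.
Proof.
move=> y0 ab; pose F x := - atan ((s - x) / y).
have dF x : is_derive x 1 F (poisson y (s - x)).
  have h1 := is_derive_div (is_derive_sub s x) (is_derive_cst y x 1) (lt0r_neq0 y0).
  have h2 := @is_derive1_comp R atan (fun u => (s - u) / cst y u) _ _ _
    (is_derive1_atan ((s - x) / y)) h1.
  have h := is_deriveN h2.
  apply: (@is_derive_eq _ _ _ _ _ _ _ _ h).
  rewrite /poisson /cst /GRing.scale/=; field.
  by rewrite (lt0r_neq0 y0) sqr_norm_neq0.
have cF : continuous F.
  move=> x; apply: differentiable_continuous; apply/derivable1_diffP.
  by have [] := dF x.
rewrite (@continuous_FTC2 _ _ F)//.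
- by rewrite -EFinB; congr EFin; rewrite /F; ring.
- by apply: continuous_subspaceT; apply: continuous_subl; exact: continuous_poisson.
- split; first by move=> x _; have [] := dF x.
  + exact: cvg_at_right_filter (cF a).
  + exact: cvg_at_left_filter (cF b).
- by move=> x _; rewrite derive1E; have [_ ->] := dF x.
Qed.

Lemma measurable_poisson_sub y s : 0 < y ->
  measurable_fun [set: measurableTypeR R] (fun x => (poisson y (s - x))%:E).
Proof.
move=> y0; apply/measurable_EFinP; apply: continuous_measurable_fun.
by apply: continuous_subl; exact: continuous_poisson.
Qed.

Lemma integral_poisson_le_pi y s a b K : 0 < y -> measurable K ->
  K `<=` `[a, b] ->
  (\int[lam]_(x in K) (poisson y (s - x))%:E <= (pi : R)%:E)%E.
Proof.
move=> y0 mK Kab.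
have mp := measurable_poisson_sub s y0.
have p0 x : (0 <= (poisson y (s - x))%:E)%E by rewrite lee_fin poisson_ge0.
have [ab|ba] := ltP a b; last first.
  apply: (@le_trans _ _ (\int[lam]_(x in `[a, a]) (poisson y (s - x))%:E)%E).
    apply: ge0_subset_integral => //.
      exact: measurable_funTS.
    move=> x /Kab; rewrite /= !in_itv/= => /andP[ax xb].
    by rewrite ax (le_trans xb).
  by rewrite set_itv1 integral_set1 lee_fin pi_ge0.
apply: (@le_trans _ _ (\int[lam]_(x in `[a, b]) (poisson y (s - x))%:E)%E).
  by apply: ge0_subset_integral => //; exact: measurable_funTS.
rewrite integral_poisson_itv// lee_fin.
have := @atan_ltpi2 R ((s - a) / y); have := @atan_gtNpi2 R ((s - b) / y).
lra.
Qed.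

Variable m : {sigma_finite_measure set (measurableTypeR R) -> \bar R}.

Lemma poisson_tonelli y K D : 0 < y -> measurable K -> measurable D ->
  (\int[lam]_(x in K) \int[m]_(s in D) (poisson y (s - x))%:E =
   \int[m]_(s in D) \int[lam]_(x in K) (poisson y (s - x))%:E)%E.
Proof.
move=> y0 mK mD.
pose f (z : measurableTypeR R * measurableTypeR R) :=
  (\1_K z.1 * \1_D z.2 * poisson y (z.2 - z.1))%:E.
have mf : measurable_fun setT f.
  apply/measurable_EFinP; apply: measurable_funM.
    apply: measurable_funM.
      exact: (measurableT_comp (measurable_indic mK) measurable_fst).
    exact: (measurableT_comp (measurable_indic mD) measurable_snd).
  apply: (@measurableT_comp _ _ _ _ _ _ (poisson y)).
    by apply: continuous_measurable_fun; exact: continuous_poisson.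
  apply: measurable_funB; [exact: measurable_snd|exact: measurable_fst].
have f0 z : (0 <= f z)%E by rewrite lee_fin mulr_ge0 ?poisson_ge0// mulr_ge0 ?indicE.
have E := fubini_tonelli (m1 := lam) (m2 := m) f mf f0.
rewrite [LHS]integral_mkcond [RHS]integral_mkcond.
transitivity (\int[lam]_x \int[m]_y0 f (x, y0))%E; [|rewrite {}E].
- apply: eq_integral => x _; rewrite patchE /f; case: ifPn => xK.
    rewrite integral_mkcond; apply: eq_integral => s _.
    rewrite patchE/= !indicE xK mul1r.
    by case: (s \in D); rewrite ?mul1r ?mul0r.
  by rewrite integral0_eq// => s _; rewrite /= indicE (negbTE xK) !mul0r.
- apply: eq_integral => s _; rewrite patchE /f; case: ifPn => sD.
    rewrite [RHS]integral_mkcond; apply: eq_integral => x _.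
    rewrite patchE/= !indicE sD mulr1.
    by case: (x \in K); rewrite ?mul1r ?mul0r.
  by rewrite integral0_eq// => x _; rewrite /= !indicE (negbTE sD) mulr0 mul0r.
Qed.

End tonelli.

(** * Vanishing of Poisson integrals off their support *)

Section off_compact.
Context {R : realType}.
Notation lam := (@lebesgue_measure R).
Implicit Types (x y s a b : R) (K D : set (measurableTypeR R)).

Lemma compact_itv K : compact (K : set R) ->
  exists2 M : R, 0 < M & K `<=` `[- M, M].
Proof.
move=> /compact_bounded[M [Mreal HM]].
exists (`|M| + 1); first by rewrite ltr_wpDl.
move=> x Kx; rewrite /= in_itv/= -ler_norml.
by apply: HM => //; rewrite (le_lt_trans (ler_norm M))// ltrDl.
Qed.

Lemma compact_dist K s : compact (K : set R) -> ~ K s ->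
  exists2 d : R, 0 < d & forall x, K x -> d <= `|s - x|.
Proof.
move=> /(compact_closed (@Rhausdorff R)) /closed_openC oK Ks.
have /nbhs_ballP[d /= d0 dK] : nbhs s (~` (K : set R)) by exact: open_nbhs_nbhs.
exists d => // x Kx; rewrite leNgt; apply/negP => sxd.
exact: (dK x sxd Kx).
Qed.

Lemma poisson_far d y t : 0 < y -> 0 < d -> d <= `|t| ->
  poisson y t <= y / d ^+ 2.
Proof.
move=> y0 d0 dt; rewrite ler_pM2l// lef_pV2 ?posrE ?exprn_gt0 ?sqr_norm_gt0//.
rewrite -[t ^+ 2]real_normK ?num_real//.
have := sqr_ge0 y; nra.
Qed.

Lemma measurable_poisson_compact K y : 0 < y -> compact (K : set R) ->
  measurable_fun [set: measurableTypeR R]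
    (fun s => \int[lam]_(x in K) (poisson y (s - x))%:E)%E.
Proof.
move=> y0 cK.
have mK : measurable K by exact: compact_measurable.
have Kfin : (lam K < +oo)%E by exact: compact_finite_measure.
have [M M0 KM] := compact_itv cK.
rewrite (_ : (fun s => _) =
    EFin \o (fun s => \int[lam]_(x in K) poisson y (s - x))); last first.
  apply/funext => s /=; rewrite fineK// ge0_fin_numE.
    exact: le_lt_trans (integral_poisson_le_pi s y0 mK KM) (ltry _).
  by apply: integral_ge0 => x _; rewrite lee_fin poisson_ge0.
apply/measurable_EFinP; apply: continuous_measurable_fun.
apply: (continuous_under mK Kfin (C := y^-1) (k := fun s x => poisson y (s - x))) => //.
- move=> s; apply: measurable_funTS; apply/measurable_EFinP.
  exact: measurable_poisson_sub.
- by move=> x s; exact: poisson_le.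
- by move=> s; apply: continuous_subr; exact: continuous_poisson.
Qed.

Variable m : {sigma_finite_measure set (measurableTypeR R) -> \bar R}.

(** A measure [m] on [D] has, near the real axis, a Poisson integral that is
    small in L^1 on a compact [K] disjoint from [D].  After exchanging the
    integrals, the mass in [K] of the Poisson kernel centred at a point [s] of
    [D] is at most [pi] and tends to [0], because [s] is at positive distance
    from [K]; dominated convergence concludes. *)
Lemma poisson_off_compact K D : compact (K : set R) -> measurable D ->
  (m D < +oo)%E -> K `&` D = set0 ->
  (\int[lam]_(x in K) \int[m]_(s in D) (poisson n.+1%:R^-1 (s - x))%:E)%E
    @[n --> \oo] --> 0%E.
Proof.
move=> cK mD Dfin KD0.
have mK : measurable K by exact: compact_measurable.
have Kfin : (lam K < +oo)%E by exact: compact_finite_measure.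
have [M M0 KM] := compact_itv cK.
have y0 n : 0 < (n.+1%:R^-1 : R) by rewrite invr_gt0.
under eq_fun do rewrite poisson_tonelli//.
pose I n s := (\int[lam]_(x in K) (poisson n.+1%:R^-1 (s - x))%:E)%E.
have mp n s := measurable_poisson_sub s (y0 n).
have I0 n s : (0 <= I n s)%E.
  by apply: integral_ge0 => x _; rewrite lee_fin poisson_ge0.
have Ipi n s : (I n s <= (pi : R)%:E)%E by apply: integral_poisson_le_pi KM.
rewrite -[0%E](integral0 m D).
apply: (dominated_cvg mD (g := cst (pi : R)%:E)) => //.
- by move=> n; apply: measurable_funTS; exact: measurable_poisson_compact.
- move=> s Ds; have [|d d0 dK] := compact_dist (s := s) cK.
    by move=> Ks; have : (K `&` D) s by []; rewrite KD0.
  pose C := fine (lam K) / d ^+ 2.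
  have IC n : (I n s <= (C * harmonic n)%:E)%E.
    apply: (@le_trans _ _ (\int[lam]_(x in K) (cst (harmonic n / d ^+ 2)%:E x))%E).
      apply: ge0_le_integral => //.
      + by move=> x _; rewrite lee_fin poisson_ge0.
      + by apply: measurable_funTS.
      + by move=> x Kx; rewrite lee_fin; apply: poisson_far => //; exact: dK.
    rewrite integral_cst//= -[lam K]fineK ?ge0_fin_numE// -EFinM lee_fin.
    by rewrite /C /harmonic/= mulrC mulrAC mulrA.
  apply: (@squeeze_cvge _ _ _ _ (cst 0%E) _ (fun n => (C * harmonic n)%:E)).
  + by apply: nearW => n; rewrite I0 IC.
  + exact: cvg_cst.
  + apply: cvg_EFin; first exact: nearW.
    rewrite -[X in _ --> X](mulr0 C); apply: cvgM; first exact: cvg_cst.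
    exact: cvg_harmonic.
- by apply/integrableP; split => //; rewrite integral_cst//= lte_mul_pinfty ?abse_ge0.
- by move=> n s _; rewrite gee0_abs ?I0 ?Ipi.
Qed.

End off_compact.

(** * Decay of the Cauchy transform at infinity *)

Section vertical_sides.
Context {R : realType}.
Variable m : probability (measurableTypeR R) R.
Implicit Types x y d : R.

(** The modulus decreases with the height, so the lowest height of a vertical
    segment controls all of it. *)
Lemma conj_poisson_mono d y t : 0 < d -> d <= y ->
  `|conj_poisson y t| <= `|conj_poisson d t|.
Proof.
move=> d0 dy; have y0 : 0 < y by exact: lt_le_trans dy.
rewrite /conj_poisson !normrM !normfV !(gtr0_norm (sqr_norm_gt0 t _))//.
rewrite ler_wpM2l// lef_pV2 ?posrE ?sqr_norm_gt0// lerD2l.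
nra.
Qed.

Lemma conj_poisson_le_inv d t : 0 < d -> `|conj_poisson d t| <= `|t|^-1.
Proof.
move=> d0; have [->|t0] := eqVneq t 0; first by rewrite /conj_poisson mul0r normr0 invr0.
rewrite /conj_poisson normrM normfV (gtr0_norm (sqr_norm_gt0 t d0)).
rewrite ler_pdivrMr ?sqr_norm_gt0// ler_pdivlMl ?normr_gt0//.
rewrite -[t ^+ 2]real_normK ?num_real//; have := sqr_ge0 d; nra.
Qed.

(** A majorant of [conj_int] on the whole vertical line above [x + i d], used to
    neglect the vertical sides of a rectangle. *)
Definition conj_bound d x : R := \int[m]_s `|conj_poisson d (s - x)|.

Lemma conj_int_le d x y : 0 < d -> d <= y -> `|conj_int m x y| <= conj_bound d x.
Proof.
move=> d0 dy; have y0 : 0 < y by exact: lt_le_trans dy.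
have i1 := integrable_conj_poisson m x y0.
have i2 := integrable_conj_poisson m x d0.
apply: (le_trans (le_normr_Rintegral measurableT i1)).
apply: le_Rintegral => //; [exact: integrable_norm|exact: integrable_norm|].
by move=> s _; exact: conj_poisson_mono.
Qed.

Lemma conj_bound_cvg d (u : R ^nat) : 0 < d ->
  (forall A, \forall n \near \oo, A <= `|u n|) ->
  conj_bound d (u n) @[n --> \oo] --> (0 : R).
Proof.
move=> d0 uoo.
suff : (\int[m]_s (`|conj_poisson d (s - u n)|)%:E)%E @[n --> \oo] --> 0%E.
  by move=> h; exact: (fine_cvg h).
rewrite -[0%E](integral0 m setT).
apply: (dominated_cvg measurableT (g := cst (d^-1)%:E)) => //.
- move=> n; apply/measurable_EFinP; apply: measurableT_comp => //.
  apply: continuous_measurable_fun; apply: continuous_subr.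
  exact: continuous_conj_poisson.
- move=> s _; apply: cvg_EFin; first exact: nearW.
  apply/cvgrPdist_le => e e0 /=; near=> n.
  rewrite sub0r normrN normr_id.
  apply: (le_trans (conj_poisson_le_inv _ d0)).
  have un : `|s| + e^-1 <= `|u n| by near: n; exact: uoo.
  have su : e^-1 <= `|s - u n|.
    have := ler_normB (s - u n) s.
    have -> : s - u n - s = - u n by ring.
    rewrite normrN; lra.
  rewrite -[leRHS]invrK lef_pV2// ?posrE ?invr_gt0//.
  by rewrite (lt_le_trans _ su)// invr_gt0.
- apply/integrableP; split => //; rewrite integral_cst//= probability_setT.
  by rewrite mule1 ltry.
- by move=> n s _; rewrite lee_fin normr_id conj_poisson_le.
Unshelve. all: end_near. Qed.

End vertical_sides.

(** * The damped Cauchy transform *)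

Section algebra.
Context {R : realType}.
Variable c : R.
Hypothesis c0 : 0 < c.
Implicit Types a b A B x y : R.

(** Let [g = a + i b] stand for [- G].  The damped transform is
    [c * g / (1 - i c g) = - c / (F + i c)], with [F = 1 / G = - 1 / g];
    [damp a b] is [|1 - i c g|^2], and [damped_im], [damped_re] are the
    imaginary and real parts of the damped transform.  [damped_der] is the real
    part of its derivative, when [A + i B] is the derivative of [g]. *)
Definition damp a b : R := (1 + c * b) ^+ 2 + (c * a) ^+ 2.
Definition damped_im a b : R := 1 - (1 + c * b) / damp a b.
Definition damped_re a b : R := c * a / damp a b.
Definition damped_der a b A B : R :=
  c * (A * ((1 + c * b) ^+ 2 - (c * a) ^+ 2) - 2 * B * (1 + c * b) * (c * a))
    / damp a b ^+ 2.

Let c_mul_ge0 t : 0 <= t -> 0 <= c * t.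
Proof. by move=> t0; rewrite mulr_ge0// ltW. Qed.

Lemma damp_ge1 a b : 0 <= b -> 1 <= damp a b.
Proof.
move=> b0; rewrite /damp; have : 0 <= c * b by exact: c_mul_ge0.
by have := sqr_ge0 (c * a); move: (c * b) => t; nra.
Qed.

Lemma damp_gt0 a b : 0 <= b -> 0 < damp a b.
Proof. by move=> b0; rewrite (lt_le_trans ltr01)// damp_ge1. Qed.

Lemma damped_imE a b : 0 <= b ->
  damped_im a b = ((1 + c * b) * (c * b) + (c * a) ^+ 2) / damp a b.
Proof.
move=> b0; rewrite /damped_im; have := lt0r_neq0 (damp_gt0 a b0).
by rewrite /damp => ?; field.
Qed.

Lemma damped_im_ge0 a b : 0 <= b -> 0 <= damped_im a b.
Proof.
move=> b0; rewrite damped_imE// divr_ge0 ?(ltW (damp_gt0 _ _))// ?addr_ge0 ?sqr_ge0//.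
have : 0 <= c * b by exact: c_mul_ge0.
nra.
Qed.

Lemma damped_im_le1 a b : 0 <= b -> damped_im a b <= 1.
Proof.
move=> b0; rewrite /damped_im gerBl divr_ge0 ?(ltW (damp_gt0 _ _))//.
by rewrite addr_ge0// c_mul_ge0.
Qed.

Lemma damped_im_le a b : 0 <= b ->
  damped_im a b <= c * b + c ^+ 2 * (a ^+ 2 + b ^+ 2).
Proof.
move=> b0; have cb : 0 <= c * b by exact: c_mul_ge0.
rewrite damped_imE// ler_pdivrMr ?damp_gt0//.
have N1 := damp_ge1 a b0.
have h : 0 <= c * b + c ^+ 2 * (a ^+ 2 + b ^+ 2).
  by rewrite addr_ge0// mulr_ge0// ?addr_ge0 ?sqr_ge0.
nra.
Qed.

(** The damped transform detects large values of the Cauchy transform, even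
    those due to its real part only. *)
Lemma damped_im_ge_half a b : 0 <= b -> 1 <= c ^+ 2 * (a ^+ 2 + b ^+ 2) ->
  2^-1 <= damped_im a b.
Proof.
move=> b0 h; rewrite damped_imE// ler_pdivlMr ?damp_gt0// /damp; nra.
Qed.

Lemma damped_re_le a b : 0 <= b -> `|damped_re a b| <= c * `|a|.
Proof.
move=> b0; rewrite /damped_re normrM normfV (gtr0_norm (damp_gt0 a b0)).
rewrite ler_pdivrMr ?damp_gt0// normrM (gtr0_norm c0).
by rewrite ler_peMr ?damp_ge1// c_mul_ge0.
Qed.

Lemma damped_der_le a b A B C : 0 <= b -> `|A| <= C -> `|B| <= C ->
  `|damped_der a b A B| <= 2 * c * C.
Proof.
move=> b0 AC BC; rewrite /damped_der normrM normfV normrX.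
rewrite (gtr0_norm (damp_gt0 a b0)) ler_pdivrMr ?exprn_gt0 ?damp_gt0//.
rewrite normrM (gtr0_norm c0) [leRHS](_ : _ = c * (2 * C * damp a b ^+ 2)); last by ring.
rewrite ler_pM2l//.
have N1 := damp_ge1 a b0; have C0 : 0 <= C by exact: le_trans AC.
apply: (@le_trans _ _ (2 * C * damp a b)); last first.
  rewrite ler_wpM2l ?mulr_ge0// expr2 ler_peMl//; lra.
rewrite /damp.
have h1 : `|(1 + c * b) ^+ 2 - (c * a) ^+ 2| <= damp a b.
  by rewrite ler_norml /damp; have := sqr_ge0 (1 + c * b); have := sqr_ge0 (c * a); lra.
have h2 : `|2 * (1 + c * b) * (c * a)| <= damp a b.
  rewrite ler_norml /damp; have := sqr_ge0 (1 + c * b + c * a);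
  have := sqr_ge0 (1 + c * b - c * a); nra.
apply: (le_trans (ler_normB _ _)).
rewrite [2 * B * _ * _](_ : 2 * B * _ * _ = B * (2 * (1 + c * b) * (c * a)));
  last by ring.
rewrite normrM (normrM B).
have := ler_pM (normr_ge0 A) (normr_ge0 _) AC h1.
have := ler_pM (normr_ge0 B) (normr_ge0 _) BC h2.
rewrite /damp; lra.
Qed.

Section derivatives.
Variables (f g : R -> R) (x A B : R).
Hypothesis g0 : 0 <= g x.

Let is_derive_Dg dg : is_derive x 1 g dg -> is_derive x 1 (fun u => 1 + c * g u) (c * dg).
Proof.
move=> hg; have h := is_deriveD (is_derive_cst (1 : R) x 1)
  (is_deriveM (is_derive_cst c x 1) hg).
by apply: (@is_derive_eq _ _ _ _ _ _ _ _ h); rewrite /GRing.scale/=; ring.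
Qed.

Let is_derive_Df df : is_derive x 1 f df -> is_derive x 1 (fun u => c * f u) (c * df).
Proof.
move=> hf; have h := is_deriveM (is_derive_cst c x 1) hf.
by apply: (@is_derive_eq _ _ _ _ _ _ _ _ h); rewrite /GRing.scale/=; ring.
Qed.

Let is_derive_damp df dg : is_derive x 1 f df -> is_derive x 1 g dg ->
  is_derive x 1 (fun u => damp (f u) (g u))
    (2 * (1 + c * g x) * (c * dg) + 2 * (c * f x) * (c * df)).
Proof.
move=> /is_derive_Df hf /is_derive_Dg hg.
exact: (is_deriveD (is_derive_sqr hg) (is_derive_sqr hf)).
Qed.

(** The damped transform inherits the Cauchy-Riemann equations: the derivative
    of its real part in [x] ([is_derive_damped_re]) and of its imaginary part in
    [y] ([is_derive_damped_im]) are the same function. *)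
Lemma is_derive_damped_re : is_derive x 1 f A -> is_derive x 1 g B ->
  is_derive x 1 (fun u => damped_re (f u) (g u)) (damped_der (f x) (g x) A B).
Proof.
move=> hf hg; have N0 := lt0r_neq0 (damp_gt0 (f x) g0).
have h := is_derive_div (is_derive_Df hf) (is_derive_damp hf hg) N0.
apply: (@is_derive_eq _ _ _ _ _ _ _ _ h).
by rewrite /damped_der; congr (_ * _); rewrite /damp; ring.
Qed.

Lemma is_derive_damped_im : is_derive x 1 f (- B) -> is_derive x 1 g A ->
  is_derive x 1 (fun u => damped_im (f u) (g u)) (damped_der (f x) (g x) A B).
Proof.
move=> hf hg; have N0 := lt0r_neq0 (damp_gt0 (f x) g0).
have h := is_deriveB (is_derive_cst (1 : R) x 1)
  (is_derive_div (is_derive_Dg hg) (is_derive_damp hf hg) N0).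
apply: (@is_derive_eq _ _ _ _ _ _ _ _ h).
by rewrite /damped_der sub0r -mulNr; congr (_ * _); rewrite /damp; ring.
Qed.

End derivatives.

Section continuity.
Variables (f g A B : R -> R).
Hypotheses (g0 : forall x, 0 <= g x) (cf : continuous f) (cg : continuous g).

Let cD : continuous (fun x => 1 + c * g x).
Proof.
move=> x; apply: cvgD; first exact: cvg_cst.
by apply: cvgM; [exact: cvg_cst|exact: cg].
Qed.

Let cF : continuous (fun x => c * f x).
Proof. by move=> x; apply: cvgM; [exact: cvg_cst|exact: cf]. Qed.

Let csqr (h : R -> R) : continuous h -> continuous (fun x => h x ^+ 2).
Proof. by move=> ch x; apply: (cvgM (ch x) (ch x)). Qed.

Let cdamp : continuous (fun x => damp (f x) (g x)).
Proof. by move=> x; apply: cvgD; [exact: (csqr cD)|exact: (csqr cF)]. Qed.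

Lemma continuous_damped_im : continuous (fun x => damped_im (f x) (g x)).
Proof.
move=> x; apply: cvgB; first exact: cvg_cst.
apply: cvgM; first exact: cD.
by apply: cvgV; [rewrite lt0r_neq0 ?damp_gt0|exact: cdamp].
Qed.

Lemma continuous_damped_der : continuous A -> continuous B ->
  continuous (fun x => damped_der (f x) (g x) (A x) (B x)).
Proof.
move=> cA cB x; apply: cvgM; last first.
  apply: cvgV; first by rewrite expf_neq0// lt0r_neq0 ?damp_gt0.
  exact: (csqr cdamp).
apply: cvgM; first exact: cvg_cst.
apply: cvgB.
  by apply: cvgM; [exact: cA|apply: cvgB; [exact: (csqr cD)|exact: (csqr cF)]].
apply: cvgM; last exact: cF.
apply: cvgM; last exact: cD.
by apply: cvgM; [exact: cvg_cst|exact: cB].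
Qed.

End continuity.
End algebra.

(** * Weak type bound by shifting a horizontal contour *)

Section contour.
Context {R : realType}.
Notation lam := (@lebesgue_measure R).
Variables (m : probability (measurableTypeR R) R) (c : R).
Hypothesis c0 : 0 < c.
Implicit Types (x y M : R).

(* [U + i V] is the damped transform of [m]; [P] is both the derivative of [U]
   in [x] and of [V] in [y]. *)
Let a := conj_int m.
Let b := poisson_int m.
Let V x y := damped_im c (a x y) (b x y).
Let U x y := damped_re c (a x y) (b x y).
Let P x y := damped_der c (a x y) (b x y) (re_inv_sqr_int m x y) (im_inv_sqr_int m x y).

Let b0 x y : 0 < y -> 0 <= b x y.
Proof. exact: poisson_int_ge0. Qed.

Let segment_fin M : (lam `[(- M)%R, M] < +oo)%E.
Proof. by apply: compact_finite_measure; exact: segment_compact. Qed.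

Lemma continuous_damped_im_int y : 0 < y -> continuous (V ^~ y).
Proof.
move=> y0; apply: continuous_damped_im => //.
- by move=> x; exact: b0.
- exact: continuous_conj_int.
- exact: continuous_poisson_int.
Qed.

Lemma norm_damped_im_int_le1 x y : 0 < y -> `|V x y| <= 1.
Proof.
by move=> y0; rewrite ger0_norm ?damped_im_le1 ?damped_im_ge0 ?b0.
Qed.

Lemma integrable_damped_im_int K y : 0 < y -> measurable K -> (lam K < +oo)%E ->
  lam.-integrable K (EFin \o (V ^~ y)).
Proof.
move=> y0 mK Kfin.
apply: measurable_bounded_integrable => //.
  apply: measurable_funTS; apply: continuous_measurable_fun.
  exact: continuous_damped_im_int.
exists 1; split; first exact: num_real.
by move=> N N1 s _ /=; rewrite (le_trans (norm_damped_im_int_le1 s y0))// ltW.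
Qed.

(** Differentiate under the integral sign and turn the [y]-derivative of [V]
    into the [x]-derivative of [U], which integrates to boundary terms.  This is
    Cauchy's theorem for a rectangle, in differential form. *)
Lemma is_derive_horizontal_integral M y : 0 < M -> 0 < y ->
  is_derive y 1 (fun y => \int[lam]_(x in `[(- M), M]) V x y) (U M y - U (- M) y).
Proof.
move=> M0 y0.
have E : \int[lam]_(x in `[(- M), M]) P x y = U M y - U (- M) y.
  have dU x : is_derive x 1 (U ^~ y) (P x y).
    apply: is_derive_damped_re => //; first exact: b0.
      exact: is_derive_conj_int1.
    exact: is_derive_poisson_int1.
  have cU : continuous (U ^~ y).
    move=> x; apply: differentiable_continuous; apply/derivable1_diffP.
    by have [] := dU x.
  rewrite /Rintegral (@continuous_FTC2 _ _ (U ^~ y))//.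
  - lra.
  - apply: continuous_subspaceT; apply: continuous_damped_der => //.
    + by move=> x; exact: b0.
    + exact: continuous_conj_int.
    + exact: continuous_poisson_int.
    + exact: continuous_re_inv_sqr_int.
    + exact: continuous_im_inv_sqr_int.
  - split; first by move=> x _; have [] := dU x.
    + exact: cvg_at_right_filter (cU _).
    + exact: cvg_at_left_filter (cU _).
  - by move=> x _; rewrite derive1E; have [_ ->] := dU x.
rewrite -E.
have hb v : y / 2 < v < y + 1 -> 0 < v by lra.
pose d := y / 2; have d0 : 0 < d by rewrite divr_gt0.
apply: (@is_derive_under _ lam _ (measurable_itv _) (segment_fin M)
  (fun y x => V x y) (fun y x => P x y) (y / 2) (y + 1) y (2 * c * (d ^+ 2)^-1)).
- lra.
- by move=> v /hb v0; exact: integrable_damped_im_int.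
- move=> v x /hb v0; apply: is_derive_damped_im => //; first exact: b0.
    exact: is_derive_conj_int2.
  exact: is_derive_poisson_int2.
- move=> v x hv; have v0 := hb _ hv.
  have dv : d <= v by rewrite /d; lra.
  apply: damped_der_le => //; first exact: b0.
    apply: (norm_int_le m (k := fun s => re_inv_sqr v (s - x))) => [|t].
      by apply: continuous_subr; exact: continuous_re_inv_sqr.
    exact: re_inv_sqr_le.
  apply: (norm_int_le m (k := fun s => im_inv_sqr v (s - x))) => [|t].
    by apply: continuous_subr; exact: continuous_im_inv_sqr.
  exact: im_inv_sqr_le.
Qed.

(** The Cauchy-Schwarz inequality [|G|^2 <= int |x + i y - s|^(-2) dm(s)], whose
    right-hand side is [- Im G / y]; equivalently, [Im F >= y]. *)
Lemma norm_cauchy_sqr_le x y : 0 < y -> a x y ^+ 2 + b x y ^+ 2 <= b x y / y.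
Proof.
move=> y0.
pose k1 s := conj_poisson y (s - x); pose k2 s := poisson y (s - x).
have i1 : m.-integrable setT (EFin \o k1) by exact: integrable_conj_poisson.
have i2 : m.-integrable setT (EFin \o k2) by exact: integrable_poisson.
have iZ k (h : measurableTypeR R -> R) : m.-integrable setT (EFin \o h) ->
    m.-integrable setT (EFin \o (fun s => k * h s)).
  by move=> ih; exact: (integrableZl measurableT k ih).
have iB (h k : measurableTypeR R -> R) : m.-integrable setT (EFin \o h) ->
    m.-integrable setT (EFin \o k) -> m.-integrable setT (EFin \o (fun s => h s - k s)).
  by move=> ih ik; exact: (integrableB measurableT ih ik).
have i3 : m.-integrable setT (EFin \o (fun s => 2 * a x y * k1 s)) by exact: iZ.
have i4 : m.-integrable setT (EFin \o (fun s => 2 * b x y * k2 s)) by exact: iZ.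
have i5 : m.-integrable setT (EFin \o (fun s => y^-1 * k2 s)) by exact: iZ.
have i6 C : m.-integrable setT (EFin \o (cst C : measurableTypeR R -> R)).
  exact: (integrable_bounded _ (probability_fin m) (C := `|C|)).
pose C := a x y ^+ 2 + b x y ^+ 2.
have i7 : m.-integrable setT (EFin \o (fun s => y^-1 * k2 s - 2 * a x y * k1 s)).
  exact: iB.
have i8 : m.-integrable setT
    (EFin \o (fun s => y^-1 * k2 s - 2 * a x y * k1 s - 2 * b x y * k2 s)).
  exact: iB.
(* The integrand is [(k1 s - a x y)^2 + (k2 s - b x y)^2]. *)
have : 0 <= \int[m]_s (y^-1 * k2 s - 2 * a x y * k1 s - 2 * b x y * k2 s + cst C s).
  apply: Rintegral_ge0 => s _.
  have -> : y^-1 * k2 s = k1 s ^+ 2 + k2 s ^+ 2.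
    rewrite /k1 /k2 /conj_poisson /poisson.
    by field; rewrite sqr_norm_neq0// lt0r_neq0.
  rewrite /C /cst; have := sqr_ge0 (k1 s - a x y); have := sqr_ge0 (k2 s - b x y).
  lra.
have EC : \int[m]_s cst C s = C.
  by rewrite Rintegral_cst//= probability_setT/= mulr1.
rewrite RintegralD// RintegralB// RintegralB// EC.
rewrite !(RintegralZl _ measurableT i1) !(RintegralZl _ measurableT i2).
have -> : \int[m]_s k1 s = a x y by [].
have -> : \int[m]_s k2 s = b x y by [].
by rewrite /C [b x y / y]mulrC; lra.
Qed.

(** High above the axis, damping hardly increases the imaginary part, because
    [norm_cauchy_sqr_le] makes the quadratic term of [damped_im_le] at most
    [c ^+ 2 / y] times the Poisson integral. *)
Lemma damped_im_int_le x y : 0 < y -> V x y <= c * (1 + c / y) * b x y.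
Proof.
move=> y0; apply: (le_trans (damped_im_le c0 _ (b0 x y0))).
have := norm_cauchy_sqr_le x y0; have := exprn_gt0 2 c0 => c2 h.
have := ler_wpM2l (ltW c2) h.
move=> h'; apply: (le_trans (lerD (lexx _) h')).
by rewrite le_eqVlt; apply/orP; left; apply/eqP; ring.
Qed.

Lemma poisson_intE x y : 0 < y ->
  (b x y)%:E = (\int[m]_s (poisson y (s - x))%:E)%E.
Proof.
move=> y0; rewrite fineK//.
by apply: integrable_fin_num => //; exact: integrable_poisson.
Qed.

Lemma integral_poisson_int_le M y : 0 < y ->
  (\int[lam]_(x in `[(- M)%R, M]) (b x y)%:E <= (pi : R)%:E)%E.
Proof.
move=> y0; under eq_integral do rewrite poisson_intE//.
rewrite (poisson_tonelli m)//.
apply: (@le_trans _ _ (\int[m]_s (cst (pi : R)%:E s))%E); last first.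
  by rewrite integral_cst//= probability_setT mule1.
apply: ge0_le_integral => //.
- by move=> s _; apply: integral_ge0 => x _; rewrite lee_fin poisson_ge0.
- by apply: measurable_poisson_compact => //; exact: segment_compact.
- move=> s _.
  exact: (integral_poisson_le_pi s y0 (measurable_itv _) (@subset_refl _ _)).
Qed.

Lemma horizontal_integral_le M y1 y2 : 0 < M -> 0 < y1 -> y1 < y2 ->
  \int[lam]_(x in `[(- M), M]) V x y1 <= \int[lam]_(x in `[(- M), M]) V x y2 +
    (y2 - y1) * (c * (conj_bound m y1 M + conj_bound m y1 (- M))).
Proof.
move=> M0 y10 y12; pose Phi y := \int[lam]_(x in `[(- M), M]) V x y.
have dPhi y : 0 < y -> is_derive y 1 Phi (U M y - U (- M) y).
  by move=> y0; exact: is_derive_horizontal_integral.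
have [|||xi xiy E] := @MVT_segment R Phi (fun y => U M y - U (- M) y) y1 y2.
- exact: ltW.
- by move=> y; rewrite in_itv/= => /andP[yy1 _]; apply: dPhi; exact: lt_trans yy1.
- apply: derivable_within_continuous => y; rewrite in_itv/= => /andP[yy1 _].
  by have [] := dPhi y (lt_le_trans y10 yy1).
have y1xi : y1 <= xi by move: xiy; rewrite in_itv/= => /andP[].
have xi0 : 0 < xi by exact: lt_le_trans y1xi.
have hU N : `|U N xi| <= c * conj_bound m y1 N.
  apply: (le_trans (damped_re_le c0 _ (b0 N xi0))).
  by rewrite ler_pM2l// conj_int_le.
have h : - (U M xi - U (- M) xi) <= c * (conj_bound m y1 M + conj_bound m y1 (- M)).
  rewrite opprB addrC mulrDr; apply: lerD; last exact: le_trans (ler_norm _) (hU _).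
  by apply: le_trans (hU M); rewrite -normrN ler_norm.
have y21 : 0 <= y2 - y1 by rewrite subr_ge0 ltW.
rewrite -lerBlDl -/(Phi y1) -/(Phi y2) -opprB E -mulNr mulrC.
exact: ler_wpM2l.
Qed.

(** Weak type estimate, uniform in [y]: enlarge [K] to a long segment, move it up
    from height [y] to height [y + c], where the integral is at most
    [2 * c * pi], and pay at most [c * pi] for the two vertical sides. *)
Lemma integral_damped_im_le K y : 0 < y -> compact (K : set R) ->
  (\int[lam]_(x in K) (V x y)%:E <= (3 * pi * c)%:E)%E.
Proof.
move=> y0 cK; have [M0 M00 KM0] := compact_itv cK.
have mK : measurable (K : set (measurableTypeR R)) by exact: compact_measurable.
have yc0 : 0 < y + c by rewrite addr_gt0.
(* [M] is taken so large that the vertical sides contribute at most [c * pi]. *)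
have [M [M0M Msmall]] : exists M, M0 <= M /\
    conj_bound m y M + conj_bound m y (- M) <= pi / c.
  have h1 : conj_bound m y n%:R @[n --> \oo] --> (0 : R).
    apply: conj_bound_cvg => // A; near=> n.
    by rewrite ger0_norm//; near: n; exact: nbhs_infty_ger.
  have h2 : conj_bound m y (- n%:R) @[n --> \oo] --> (0 : R).
    apply: conj_bound_cvg => // A; near=> n.
    by rewrite normrN ger0_norm//; near: n; exact: nbhs_infty_ger.
  have hcvg : (conj_bound m y n%:R + conj_bound m y (- n%:R)) @[n --> \oo] --> (0 : R).
    by rewrite -[X in _ --> X](addr0 0); apply: cvgD.
  have pc0 : 0 < pi / c by rewrite divr_gt0// pi_gt0.
  have h := cvgr_lt _ hcvg _ pc0.
  near \oo => n; exists n%:R; split; first by near: n; exact: nbhs_infty_ger.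
  by apply: ltW; near: n; exact: h.
have M_gt0 : 0 < M by exact: lt_le_trans M0M.
have KM : K `<=` `[- M, M].
  by move=> x /KM0; rewrite /= !in_itv/= => /andP[? ?]; lra.
have iV z : 0 < z -> lam.-integrable `[- M, M] (EFin \o (V ^~ z)).
  by move=> z0; apply: integrable_damped_im_int.
apply: (@le_trans _ _ (\int[lam]_(x in `[(- M)%R, M]) (V x y)%:E)%E).
  apply: ge0_subset_integral => //.
  - exact: (measurable_int lam (iV y y0)).
  - by move=> x _; rewrite lee_fin damped_im_ge0// b0.
rewrite -[leLHS]fineK; last by apply: integrable_fin_num => //; exact: iV.
rewrite lee_fin.
have ylt : y < y + c by rewrite ltrDl.
apply: (le_trans (horizontal_integral_le M_gt0 y0 ylt)).
have hb : \int[lam]_(x in `[- M, M]) V x (y + c) <= 2 * c * pi.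
  rewrite -lee_fin fineK; last by apply: integrable_fin_num => //; exact: iV.
  apply: (@le_trans _ _
    (\int[lam]_(x in `[(- M)%R, M]) ((2 * c)%:E * (b x (y + c))%:E))%E).
    have mb : measurable_fun `[- M, M] (b ^~ (y + c)).
      apply: measurable_funTS; apply: continuous_measurable_fun.
      exact: continuous_poisson_int.
    apply: ge0_le_integral => //.
    - by move=> x _; rewrite lee_fin damped_im_ge0// b0.
    - exact: (measurable_int lam (iV _ yc0)).
    - by apply/measurable_EFinP; apply: measurable_funM.
    - move=> x _; rewrite -EFinM lee_fin; apply: (le_trans (damped_im_int_le x yc0)).
      apply: ler_wpM2r; first exact: b0.
      rewrite [2 * c]mulrC ler_pM2l//.
      have : c / (y + c) <= 1 by rewrite ler_pdivrMr// mul1r lerDr ltW.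
      lra.
  rewrite ge0_integralZl//.
  - rewrite (EFinM (2 * c) pi) lee_pmul2l// ?lte_fin ?mulr_gt0//.
    exact: integral_poisson_int_le.
  - apply/measurable_EFinP; apply: measurable_funTS; apply: continuous_measurable_fun.
    exact: continuous_poisson_int.
  - by move=> x _; rewrite lee_fin b0.
  - by rewrite lee_fin mulr_ge0 ?ltW.
have hc : c * (c * (conj_bound m y M + conj_bound m y (- M))) <= c * pi.
  rewrite ler_pM2l//; have := ler_wpM2l (ltW c0) Msmall.
  by rewrite mulrCA divff ?mulr1// lt0r_neq0.
have -> : y + c - y = c by ring.
have -> : 3 * pi * c = 2 * c * pi + c * pi by ring.
exact: lerD.
Unshelve. all: end_near. Qed.

End contour.

(** * Comparison of a measure with its Boolean power at one point *)

Section pointwise.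
Context {R : realType}.

(** Here [a + i b] and [aq + i bq] are the values of [- G] and [- G_q] at
    [x + i y], and the two equations are the two parts of the Boolean power
    relation.  When [|G_q| < 1 / c], the number [|F_q|] is bounded below by [c],
    so [|F|] is at most a multiple of [|F_q|], while [Im F] is at least a
    multiple of [Im F_q = bq * |F_q|^2] once [y] is small.  Hence
    [b = Im F / |F|^2] is bounded below. *)
Lemma boolean_power_dichotomy (q c eta M : R) :
  0 < q -> 0 < c -> 0 < eta -> 0 < M ->
  exists y0 C, [/\ 0 < y0, 0 < C & forall x y a b aq bq : R,
    `|x| <= M -> 0 < y -> y <= y0 -> 0 <= b -> eta <= bq ->
    x + aq / (aq ^+ 2 + bq ^+ 2) = q * (x + a / (a ^+ 2 + b ^+ 2)) ->
    y - bq / (aq ^+ 2 + bq ^+ 2) = q * (y - b / (a ^+ 2 + b ^+ 2)) ->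
    c ^+ 2 * (aq ^+ 2 + bq ^+ 2) < 1 -> 1 <= C * b].
Proof.
move=> q0 c0 eta0 M0.
have c20 : 0 < c ^+ 2 by rewrite exprn_gt0.
pose k := `|1 - q|; have k0 : 0 <= k by exact: normr_ge0.
pose C1 := 2 + 2 * k ^+ 2 * (M ^+ 2 + 1) / c ^+ 2.
have C10 : 0 < C1.
  rewrite /C1 ltr_wpDr// divr_ge0 ?(ltW c20)// mulr_ge0// ?mulr_ge0 ?sqr_ge0//.
  by rewrite addr_ge0 ?sqr_ge0.
pose y1 := eta * c ^+ 2 / (2 * (k + 1)).
have y10 : 0 < y1 by rewrite /y1 !(divr_gt0, mulr_gt0)//; lra.
exists (Num.min 1 y1), (2 * C1 / (eta * q)).
split; [by rewrite lt_min ltr01|by rewrite !(divr_gt0, mulr_gt0)|].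
move=> x y a b aq bq xM y0; rewrite le_min => /andP[yle1 yley1] b0 etab.
have bq0 : 0 < bq by exact: lt_le_trans etab.
set nq := aq ^+ 2 + bq ^+ 2; set n := a ^+ 2 + b ^+ 2.
have nq0 : 0 < nq by rewrite /nq ltr_wpDl ?sqr_ge0// exprn_gt0.
(* [w = |F_q|^2] and [u = |F|^2], the latter being [0] if [n = 0]. *)
pose w := nq^-1; pose u := n^-1.
have w0 : 0 < w by rewrite invr_gt0.
have wnq : w * nq = 1 by rewrite mulVf// lt0r_neq0.
rewrite -/w -/u => Ex Ey cn.
have cw : c ^+ 2 < w by rewrite /w -[ltRHS]mul1r ltr_pdivlMr.
have ky : k * y <= eta * w / 2.
  apply: (@le_trans _ _ (k * y1)); first by rewrite ler_wpM2l.
  rewrite /y1 mulrA ler_pdivrMr; last by lra.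
  have : eta * c ^+ 2 <= eta * w by rewrite ler_pM2l// ltW.
  have : 0 <= eta * c ^+ 2 by rewrite ltW// mulr_gt0.
  move: (eta * c ^+ 2) (eta * w) => s t; nra.
have kq1 : - k <= 1 - q <= k by rewrite -ler_norml.
have k2 : (1 - q) ^+ 2 = k ^+ 2 by rewrite /k real_normK ?num_real.
have Ex' : q * (a * u) = aq * w + (1 - q) * x by lra.
have Ey' : q * (b * u) = bq * w - (1 - q) * y by lra.
have bu : eta * w / 2 <= q * (b * u).
  rewrite Ey'; have : eta * w <= bq * w by rewrite ler_pM2r.
  have : (1 - q) * y <= k * y by rewrite ler_pM2r//; lra.
  lra.
have bu0 : 0 < q * (b * u).
  by apply: lt_le_trans bu; rewrite divr_gt0// mulr_gt0.
have n_neq0 : n != 0.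
  by apply/eqP => n0; move: bu0; rewrite /u n0 invr0 !mulr0 ltxx.
have n0 : 0 < n by rewrite lt_neqAle eq_sym n_neq0 addr_ge0 ?sqr_ge0.
have u0 : 0 < u by rewrite invr_gt0.
have un : u * n = 1 by rewrite mulVf.
(* [q * F = F_q - (1 - q) * z], and [z] is bounded while [|F_q| >= c]. *)
have qu : q ^+ 2 * u <= C1 * w.
  have -> : q ^+ 2 * u = (q * (a * u)) ^+ 2 + (q * (b * u)) ^+ 2.
    by rewrite -[u in LHS]mulr1 -un /n; ring.
  rewrite Ex' Ey'.
  have hx : x ^+ 2 <= M ^+ 2.
    by rewrite -[x ^+ 2]real_normK ?num_real// lerXn2r ?nnegrE// ltW.
  have hy : y ^+ 2 <= 1 by rewrite expr_le1// ltW.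
  apply: (@le_trans _ _ (2 * w * (w * nq) + 2 * (k ^+ 2 * (M ^+ 2 + 1)))).
    rewrite /nq -k2.
    have h1 := sqr_ge0 (aq * w - (1 - q) * x).
    have h2 := sqr_ge0 (bq * w + (1 - q) * y).
    have h3 : (1 - q) ^+ 2 * (x ^+ 2 + y ^+ 2) <= (1 - q) ^+ 2 * (M ^+ 2 + 1).
      by rewrite ler_wpM2l ?sqr_ge0// lerD.
    nra.
  rewrite wnq mulr1 /C1 [leRHS]mulrDl lerD2l.
  have -> : 2 * k ^+ 2 * (M ^+ 2 + 1) / c ^+ 2 * w =
      2 * (k ^+ 2 * (M ^+ 2 + 1)) * (w / c ^+ 2) by ring.
  apply: ler_peMr; last by rewrite ler_pdivlMr// mul1r ltW.
  by rewrite !mulr_ge0// ?sqr_ge0// addr_ge0 ?sqr_ge0.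
have h : eta * q * u <= 2 * C1 * (b * u).
  rewrite -(ler_pM2r w0).
  have s1 : eta * q * u * w <= 2 * q ^+ 2 * u * (b * u).
    have := ler_wpM2l (ltW q0) bu; have := ler_wpM2l (ltW u0) bu.
    nra.
  apply: (le_trans s1).
  have bu0' : 0 <= b * u by rewrite mulr_ge0// ltW.
  have := ler_wpM2r bu0' qu; nra.
rewrite mulrAC ler_pdivlMr ?mulr_gt0// mul1r.
by move: h; rewrite mulrA ler_pM2r.
Qed.

End pointwise.

(** * The Boolean power relation in real coordinates *)

Section coordinates.
Context {R : realType}.
Local Open Scope complex_scope.
Implicit Types m : probability (measurableTypeR R) R.

Lemma inv_subE (x y s : R) :
  (x +i* y - s%:C)^-1 = (- conj_poisson y (s - x)) +i* (- poisson y (s - x)).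
Proof.
apply/eqP; rewrite eq_complex /= /conj_poisson /poisson oppr0 addr0.
by rewrite -(sqrrN (s - x)) opprB -mulNr opprB !eqxx.
Qed.

Lemma cauchy_transformE m (x y : R) : 0 < y ->
  cauchy_transform m (x +i* y) = (- conj_int m x y) +i* (- poisson_int m x y).
Proof.
move=> y0; rewrite /cauchy_transform; congr (_ +i* _).
  under eq_Rintegral do rewrite inv_subE/= -mulN1r.
  by rewrite RintegralZl ?mulN1r//; exact: integrable_conj_poisson.
under eq_Rintegral do rewrite inv_subE/= -mulN1r.
by rewrite RintegralZl ?mulN1r//; exact: integrable_poisson.
Qed.

Lemma boolean_powerE (q x y : R) m mq : 0 < y -> is_boolean_power q m mq ->
  let a := conj_int m x y in let b := poisson_int m x y in
  let aq := conj_int mq x y in let bq := poisson_int mq x y in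
  x + aq / (aq ^+ 2 + bq ^+ 2) = q * (x + a / (a ^+ 2 + b ^+ 2)) /\
  y - bq / (aq ^+ 2 + bq ^+ 2) = q * (y - b / (a ^+ 2 + b ^+ 2)).
Proof.
move=> y0 /(_ (x +i* y)) E a b aq bq; have := E y0.
rewrite /E_transform /F_transform !cauchy_transformE// -/a -/b -/aq -/bq.
move=> /eqP; rewrite eq_complex /= => /andP[/eqP E1 /eqP E2]; split.
  move: E1; rewrite !sqrrN !mulNr !opprK mul0r subr0; exact.
move: E2; rewrite !sqrrN !mulNr !opprK mul0r addr0; exact.
Qed.

Lemma boolean_power_inv (q : R) m mq : 0 < q -> is_boolean_power q m mq ->
  is_boolean_power q^-1 mq m.
Proof.
move=> q0 h z zH; rewrite h// mulrA.
rewrite (_ : (q^-1)%:C * q%:C = 1) ?mul1r//.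
by rewrite -rmorphM/= mulVf ?lt0r_neq0.
Qed.

End coordinates.

(** * Lower bound for a Poisson integral from a density bound *)

Section density_bound.
Context {R : realType}.
Notation lam := (@lebesgue_measure R).
Implicit Types (x y s : R) (K D B : set (measurableTypeR R)).

Lemma poisson_near y t : 0 < y -> `|t| <= y -> (2 * y)^-1 <= poisson y t.
Proof.
move=> y0 ty; rewrite /poisson ler_pdivlMr ?sqr_norm_gt0// ler_pdivrMl ?mulr_gt0//.
rewrite -[t ^+ 2]real_normK ?num_real//.
have := normr_ge0 t; nra.
Qed.

Lemma measure_near_le (m : {measure set (measurableTypeR R) -> \bar R}) x y B D :
  0 < y -> measurable B -> measurable D -> B `<=` D -> B `<=` `[x - y, x + y] ->
  ((2 * y)^-1%:E * m B <= \int[m]_(s in D) (poisson y (s - x))%:E)%E.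
Proof.
move=> y0 mB mD BD Bxy.
have mp : measurable_fun [set: measurableTypeR R] (fun s => (poisson y (s - x))%:E).
  apply/measurable_EFinP; apply: continuous_measurable_fun; apply: continuous_subr.
  exact: continuous_poisson.
have p0 s : (0 <= (poisson y (s - x))%:E)%E by rewrite lee_fin poisson_ge0.
apply: (@le_trans _ _ (\int[m]_(s in B) (poisson y (s - x))%:E)%E); last first.
  by apply: ge0_subset_integral => //; exact: measurable_funTS.
rewrite -integral_cst//; apply: ge0_le_integral => //.
- by move=> s _; rewrite lee_fin invr_ge0 mulr_ge0// ltW.
- exact: measurable_funTS.
- move=> s /Bxy; rewrite /= in_itv/= => /andP[h1 h2].
  by rewrite lee_fin poisson_near// ler_norml; lra.
Qed.

(** The Poisson kernel is at least [1 / (2 y)] on the interval of radius [y]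
    around [x], whose Lebesgue measure is [2 y].  The part of that interval in
    [K] feeds the Poisson integral of [m] through the density bound; the part
    off [K] is accounted for by the Poisson integral of Lebesgue measure off
    [K].  As [y <= 1], only points of [[- (M + 1), M + 1]] matter. *)
Lemma poisson_int_density (m : probability (measurableTypeR R) R) K (M eta : R) x y :
  0 < eta -> compact (K : set R) -> K `<=` `[- M, M] ->
  (forall B, measurable B -> B `<=` K -> (eta%:E * lam B <= m B)%E) ->
  K x -> 0 < y -> y <= 1 ->
  eta * (1 - \int[lam]_(s in `[- (M + 1), M + 1] `\` K) poisson y (s - x))
    <= poisson_int m x y.
Proof.
move=> eta0 cK KM dens Kx y0 y1; set e := \int[_]_(_ in _) _.
have mK : measurable K by exact: compact_measurable.
set D := `[- (M + 1), M + 1] `\` K.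
have mD : measurable D by apply: measurableD.
pose I : set (measurableTypeR R) := `[x - y, x + y]%classic.
have mI : measurable I by exact: measurable_itv.
have xM := KM x Kx; move: xM; rewrite /= in_itv/= => /andP[xM1 xM2].
have IM : I `<=` `[- (M + 1), M + 1].
  by move=> s; rewrite /I /= !in_itv/= => /andP[? ?]; lra.
have lamI : lam I = (2 * y)%:E.
  rewrite /I lebesgue_measure_itv/= lte_fin ifT; last by lra.
  by rewrite -EFinD; congr EFin; ring.
have lamIK : (lam (I `&` K) + lam (I `\` K) = (2 * y)%:E)%E.
  by rewrite -lamI addeC -measureDI.
have eE : (e%:E = \int[lam]_(s in D) (poisson y (s - x))%:E)%E.
  rewrite /e fineK//; apply: integrable_fin_num => //.
  apply: (integrable_bounded mD _ (C := y^-1)).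
  - apply: (@le_lt_trans _ _ (lam `[(- (M + 1))%R, (M + 1)%R])).
      by apply: le_measure; rewrite ?inE//; exact: subDsetl.
    by rewrite lebesgue_measure_itv/=; case: ifP => _; rewrite -?EFinD ltry.
  - apply: measurable_funTS; apply: continuous_measurable_fun; apply: continuous_subr.
    exact: continuous_poisson.
  - by move=> s; exact: poisson_le.
have h1 : ((2 * y)^-1%:E * lam (I `\` K) <= e%:E)%E.
  rewrite eE; apply: measure_near_le => //.
  - exact: measurableD.
  - exact: setSD.
have h2 : ((2 * y)^-1%:E * (eta%:E * lam (I `&` K)) <= (poisson_int m x y)%:E)%E.
  rewrite poisson_intE//; apply: (@le_trans _ _ ((2 * y)^-1%:E * m (I `&` K))%E).
    rewrite lee_pmul2l ?lte_fin ?invr_gt0 ?mulr_gt0//.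
    by apply: dens; [exact: measurableI|exact: subIsetr].
  apply: measure_near_le => //; exact: measurableI.
have f1 : lam (I `&` K) \is a fin_num.
  rewrite ge0_fin_numE//; apply: (@le_lt_trans _ _ (2 * y)%:E); last exact: ltry.
  by rewrite -lamIK leeDl.
have f2 : lam (I `\` K) \is a fin_num.
  rewrite ge0_fin_numE//; apply: (@le_lt_trans _ _ (2 * y)%:E); last exact: ltry.
  by rewrite -lamIK leeDr.
move: lamIK h1 h2; rewrite -(fineK f1) -(fineK f2) -EFinD -!EFinM !lee_fin => -[E1] h1 h2.
set p := fine _ in E1 h2; set r := fine _ in E1 h1.
apply: le_trans h2.
have -> : (2 * y)^-1 * (eta * p) = eta * ((2 * y)^-1 * p) by ring.
rewrite ler_pM2l//.
have -> : p = 2 * y - r by lra.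
rewrite mulrBr mulVf ?lt0r_neq0 ?mulr_gt0//; lra.
Qed.

End density_bound.

(** * Null sets of a Boolean power *)

Section transfer.
Context {R : realType}.
Notation lam := (@lebesgue_measure R).
Implicit Types (x y s : R) (A B K D : set (measurableTypeR R)).
Implicit Types m mq : probability (measurableTypeR R) R.

Lemma poisson_int_off m K x y : 0 < y -> measurable K -> m K = 0%E ->
  (poisson_int m x y)%:E = (\int[m]_(s in ~` K) (poisson y (s - x))%:E)%E.
Proof.
move=> y0 mK mK0; rewrite poisson_intE// -setTD.
rewrite (ge0_negligible_integral mK)//.
- apply/measurable_EFinP; apply: continuous_measurable_fun; apply: continuous_subr.
  exact: continuous_poisson.
- by move=> s _; rewrite lee_fin poisson_ge0.
Qed.

(** On a compact set that [m] does not charge, the Boolean power [mq] cannot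
    dominate a positive multiple of Lebesgue measure, unless the set is null.
    The three error terms in [key] have small integrals over [K]: at most
    [3 * pi * c] for the damped transform, and [o(1)] for the other two as the
    height tends to [0]. *)
Lemma boolean_power_null (q eta : R) m mq K : 0 < q -> 0 < eta ->
  is_boolean_power q m mq -> compact (K : set R) -> m K = 0%E ->
  (forall B, measurable B -> B `<=` K -> (eta%:E * lam B <= mq B)%E) ->
  lam K = 0%E.
Proof.
move=> q0 eta0 pow cK mK0 dens; have [M M0 KM] := compact_itv cK.
have mK : measurable K by exact: compact_measurable.
have Kfin : (lam K < +oo)%E by exact: compact_finite_measure.
apply/eqP; rewrite eq_le measure_ge0 andbT leNgt; apply/negP => lamK0.
pose L := fine (lam K).
have LE : lam K = L%:E by rewrite fineK// ge0_fin_numE.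
have L0 : 0 < L by rewrite -lte_fin -LE.
(* With this [c], the bound [3 * pi * c] is [L / 8]. *)
pose c := L / (24 * pi).
have pi0 : 0 < pi :> R by exact: pi_gt0.
have c0 : 0 < c by rewrite divr_gt0// mulr_gt0.
have eta20 : 0 < eta / 2 by rewrite divr_gt0.
have [y0 [C [y00 C0 dich]]] := boolean_power_dichotomy q0 c0 eta20 M0.
(* [e] is the Poisson integral of Lebesgue measure on [D], that is, off [K]. *)
pose D := `[- (M + 1), M + 1] `\` K.
have mD : measurable (D : set (measurableTypeR R)) by apply: measurableD.
have Dfin : (lam D < +oo)%E.
  apply: (@le_lt_trans _ _ (lam `[(- (M + 1))%R, (M + 1)%R])).
    by apply: le_measure; rewrite ?inE//; exact: subDsetl.
  by rewrite lebesgue_measure_itv/=; case: ifP => _; rewrite -?EFinD ltry.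
pose e y x := \int[lam]_(s in D) poisson y (s - x).
pose b y x := poisson_int m x y.
pose V y x := damped_im c (conj_int mq x y) (poisson_int mq x y).
have h1 : (\int[lam]_(x in K) (b n.+1%:R^-1 x)%:E)%E @[n --> \oo] --> 0%E.
  have Cfin : (m (~` K) < +oo)%E.
    exact: (le_lt_trans (probability_le1 m (measurableC mK)) (ltry _)).
  have := @poisson_off_compact R m K (~` K) cK (measurableC mK) Cfin (setICr _).
  by under eq_fun do under eq_integral do rewrite -poisson_int_off//.
have eE y x : 0 < y -> (e y x)%:E = (\int[lam]_(s in D) (poisson y (s - x))%:E)%E.
  move=> yy0; rewrite /e fineK//; apply: integrable_fin_num => //.
  apply: (integrable_bounded mD Dfin (C := y^-1)).
  - apply: measurable_funTS; apply: continuous_measurable_fun; apply: continuous_subr.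
    exact: continuous_poisson.
  - by move=> s; exact: poisson_le.
have h2 : (\int[lam]_(x in K) (e n.+1%:R^-1 x)%:E)%E @[n --> \oo] --> 0%E.
  have KD0 : K `&` D = set0 by apply/seteqP; split => // s [Ks [_ nKs]]; exact: nKs.
  have := @poisson_off_compact R lam K D cK mD Dfin KD0.
  by under eq_fun do under eq_integral do rewrite -eE//.
pose d := L / (8 * (C + 1)).
have d0 : 0 < d by rewrite divr_gt0// mulr_gt0//; lra.
have [n [n1 n2 n3]] : exists n, [/\ n.+1%:R^-1 <= y0,
    (\int[lam]_(x in K) (b n.+1%:R^-1 x)%:E <= d%:E)%E &
    (\int[lam]_(x in K) (e n.+1%:R^-1 x)%:E <= (L / 8)%:E)%E].
  have dE0 : (0 < d%:E)%E by rewrite lte_fin.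
  have L80 : (0 < (L / 8)%:E)%E by rewrite lte_fin divr_gt0.
  have g0 : \forall n \near \oo, harmonic n <= y0.
    by apply: cvgr_le y00; exact: cvg_harmonic.
  have g1 := h1 _ (open_ereal_lt' dE0).
  have g2 := h2 _ (open_ereal_lt' L80).
  have [n _ /(_ n (leqnn n)) [[/= ? /ltW ?] /ltW ?]] := filterI (filterI g0 g1) g2.
  by exists n.
pose y : R := n.+1%:R^-1.
have yy0 : 0 < y by rewrite invr_gt0.
have y1 : y <= 1 by rewrite invf_le1// ler1n.
have b0 x : 0 <= b y x by exact: poisson_int_ge0.
have bq0 x : 0 <= poisson_int mq x y by exact: poisson_int_ge0.
have V0 x : 0 <= V y x by rewrite damped_im_ge0.
have e0 x : 0 <= e y x by apply: Rintegral_ge0 => s _; rewrite poisson_ge0.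
have key x : K x -> 2^-1 <= V y x + C * b y x + e y x.
  move=> Kx; have Cb : 0 <= C * b y x by rewrite mulr_ge0// ltW.
  have [|elt] := leP 2^-1 (e y x); first by have := V0 x; lra.
  have etab : eta / 2 <= poisson_int mq x y.
    apply: le_trans (poisson_int_density eta0 cK KM dens Kx yy0 y1).
    by rewrite ler_pM2l// -/(e y x); lra.
  have [cge|clt] := leP 1 (c ^+ 2 * (conj_int mq x y ^+ 2 + poisson_int mq x y ^+ 2)).
    have : 2^-1 <= V y x by exact: damped_im_ge_half.
    by have := e0 x; lra.
  have xM : `|x| <= M by have := KM x Kx; rewrite /= in_itv/= ler_norml.
  have [E1 E2] := boolean_powerE x yy0 pow.
  have := dich _ _ _ _ _ _ xM yy0 n1 (b0 x) etab E1 E2 clt.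
  by have := V0 x; have := e0 x; rewrite -/(b y x); lra.
have cb : continuous (b y) by exact: continuous_poisson_int.
have ce : continuous (e y).
  apply: (continuous_under mD Dfin (C := y^-1) (k := fun x s => poisson y (s - x))).
  - move=> x; apply: measurable_funTS; apply: continuous_measurable_fun.
    by apply: continuous_subr; exact: continuous_poisson.
  - by move=> x s; exact: poisson_le.
  - by move=> s; apply: continuous_subl; exact: continuous_poisson.
have cV : continuous (V y) by exact: continuous_damped_im_int.
have mK' (h : R -> R) : continuous h -> measurable_fun K (EFin \o h).
  move=> ch; apply/measurable_EFinP; apply: measurable_funTS.
  exact: continuous_measurable_fun.
have mb := mK' _ cb; have me := mK' _ ce; have mV := mK' _ cV.
have : ((L / 2)%:E <= \int[lam]_(x in K) ((V y x)%:E + C%:E * (b y x)%:E + (e y x)%:E))%E.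
  have -> : ((L / 2)%:E = \int[lam]_(x in K) (cst 2^-1%:E x))%E.
    rewrite integral_cst//; transitivity (2^-1%:E * L%:E)%E.
      by rewrite -EFinM mulrC.
    by rewrite -LE.
  have mCb : measurable_fun K (fun x => (C%:E * (b y x)%:E)%E) by exact: emeasurable_funM.
  have msum : measurable_fun K (fun x => ((V y x)%:E + C%:E * (b y x)%:E + (e y x)%:E)%E).
    by apply: emeasurable_funD => //; exact: emeasurable_funD.
  apply: ge0_le_integral => //.
  - by move=> x _; rewrite /cst lee_fin invr_ge0.
rewrite ge0_integralD//; last 3 first.
- by move=> x _; rewrite -EFinM -EFinD lee_fin addr_ge0// mulr_ge0// ltW.
- by apply: emeasurable_funD => //; exact: emeasurable_funM.
- by move=> x _; rewrite lee_fin.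
rewrite ge0_integralD//; last 3 first.
- by move=> x _; rewrite lee_fin.
- by move=> x _; rewrite -EFinM lee_fin mulr_ge0// ltW.
- exact: emeasurable_funM.
rewrite ge0_integralZl//; last 2 first.
- by move=> x _; rewrite lee_fin.
- by rewrite lee_fin ltW.
have hV : (\int[lam]_(x in K) (V y x)%:E <= (L / 8)%:E)%E.
  apply: (le_trans (integral_damped_im_le mq c0 yy0 cK)).
  have cancel_pi (p : R) : 0 < p -> 3 * p * (L / (24 * p)) = L / 8.
    by move=> p0; field; rewrite lt0r_neq0.
  by rewrite /c cancel_pi.
have hb : (C%:E * \int[lam]_(x in K) (b y x)%:E <= (L / 8)%:E)%E.
  apply: (@le_trans _ _ (C%:E * d%:E)%E).
    by rewrite lee_pmul2l ?lte_fin.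
  rewrite -EFinM lee_fin /d mulrA ler_pdivrMr; last by lra.
  have -> : L / 8 * (8 * (C + 1)) = C * L + L by field.
  by rewrite lerDl ltW.
move=> h; have := le_trans h (leeD (leeD hV hb) n3).
rewrite -!EFinD lee_fin; lra.
Qed.

End transfer.

(** * Absolutely continuous parts and their supports *)

Section absolute_continuity.
Context {R : realType}.
Notation lam := (@lebesgue_measure R).
Implicit Types (A B K : set (measurableTypeR R)).
Implicit Types nu sigma : {measure set (measurableTypeR R) -> \bar R}.
Implicit Types mu : probability (measurableTypeR R) R.

(** The Radon-Nikodym density of [nu] exceeds some [1 / (k + 1)] on a subset of
    [A] of positive Lebesgue measure, in which inner regularity finds [K]. *)
Lemma density_on_compact nu A : (nu setT < +oo)%E -> nu `<< lam ->
  measurable A -> (0 < nu A)%E ->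
  exists K, exists2 eta : R, 0 < eta &
    [/\ compact (K : set R), K `<=` A, (0 < lam K)%E &
      forall B, measurable B -> B `<=` K -> (eta%:E * lam B <= nu B)%E].
Proof.
move=> nufin nulam mA nuA0.
have nufE B : mfrestr measurableT nufin B = nu B by rewrite /mfrestr /mrestr setIT.
have nuflam : mfrestr measurableT nufin `<< lam.
  by move=> N /nulam + B mB BN => /(_ B mB BN); rewrite nufE.
have [f [f0 ffin intf fE]] := radon_nikodym_sigma_finite nuflam.
have nuE B : measurable B -> nu B = (\int[lam]_(x in B) f x)%E.
  by move=> mB; rewrite -(nufE B); exact: fE.
have mf : measurable_fun setT f by exact: measurable_int intf.
pose Bk k := A `&` [set x | (k.+1%:R^-1%:E <= f x)%E].
have mBk k : measurable (Bk k).
  by rewrite /Bk; apply: emeasurable_fun_c_infty => //; exact: measurable_funTS.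
have [k Bk0] : exists k, (0 < lam (Bk k))%E.
  apply: contrapT => /forallNP Bk0.
  have lamBk k : lam (Bk k) = 0%E.
    by apply/eqP; rewrite eq_le measure_ge0 andbT leNgt; apply/negP/Bk0.
  pose N := \bigcup_k Bk k.
  have mN : measurable N by exact: bigcupT_measurable.
  have lamN : lam N = 0%E.
    apply/(measure0_null_setP _ mN)/negligible_null_set/negligible_bigcup => k.
    by exists (Bk k); split; [exact: mBk|exact: lamBk|exact: subset_refl].
  move: nuA0; rewrite nuE// (ge0_negligible_integral mN)//; last exact: measurable_funTS.
  rewrite integral0_eq ?ltxx// => x [Ax Nx].
  apply/eqP; rewrite eq_le f0 andbT leNgt; apply/negP => fx0.
  have r0 : 0 < fine (f x) by rewrite -lte_fin fineK.
  have [n _ /(_ n (leqnn n)) /= /ltW hn] := near_infty_natSinv_lt (PosNum r0).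
  by apply: Nx; exists n => //; split => //=; rewrite -[leRHS]fineK// lee_fin.
move: Bk0; rewrite (lebesgue_regularity_inner_sup (mBk k)).
move=> /ereal_sup_gt[_ [K [cK KBk] <-] K0].
exists K, k.+1%:R^-1; first by rewrite invr_gt0.
split => //; first by move=> x /KBk [].
move=> B mB BK; rewrite nuE// -integral_cst//; apply: ge0_le_integral => //.
- by move=> x _; rewrite lee_fin invr_ge0.
- exact: measurable_funTS.
- by move=> x /BK /KBk [].
Qed.

Lemma ac_part_le mu nu A : is_ac_part mu nu -> measurable A -> (nu A <= mu A)%E.
Proof. by move=> [_ [sigma _ E]] mA; rewrite E// leeDl. Qed.

Lemma ac_part_fin mu nu : is_ac_part mu nu -> (nu setT < +oo)%E.
Proof.
move=> h; apply: (le_lt_trans (ac_part_le h measurableT)).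
by rewrite probability_setT ltry.
Qed.

(** If [nu_q] charged a [nu]-null set, then it would still charge that set
    deprived of the Lebesgue-null carrier of the singular part of [mu]; the
    rest is [mu]-null, which [boolean_power_null] forbids. *)
Lemma ac_part_boolean_power (q : R) mu mu_q nu nu_q : 0 < q ->
  is_boolean_power q mu mu_q -> is_ac_part mu nu -> is_ac_part mu_q nu_q ->
  nu_q `<< nu.
Proof.
move=> q0 pow acnu acnuq.
have [_ [sigma [N [mN N0 sigmaN]] muE]] := acnu.
have [nuqlam _] := acnuq.
move=> Z Z0 A mA AZ; have nuA0 := Z0 A mA AZ.
apply/eqP; rewrite eq_le measure_ge0 andbT leNgt; apply/negP => nuqA.
have mAN : measurable (A `\` N) by exact: measurableD.
have nuqN : nu_q N = 0%E.
  by apply: (nuqlam N) => //; apply/(measure0_null_setP _ mN).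
have nuqAN : (0 < nu_q (A `\` N))%E.
  apply: (lt_le_trans nuqA); rewrite (measureDI nu_q mA mN) addeC.
  rewrite -[leRHS]add0e leeD2r// -nuqN.
  by apply: le_measure; rewrite ?inE//; exact: measurableI.
have [K [eta eta0 [cK KAN K0 dens]]] :=
  density_on_compact (ac_part_fin acnuq) nuqlam mAN nuqAN.
have mK : measurable K by exact: compact_measurable.
have nuK : nu K = 0%E.
  by apply: Z0 => // x /KAN [Ax _]; exact: AZ.
have mNC : measurable (~` N) by exact: measurableC.
have sigmaK : sigma K = 0%E.
  have : (sigma K <= sigma (~` N))%E.
    by apply: le_measure; rewrite ?inE// => x /KAN [].
  by rewrite sigmaN measure_le0 => /eqP.
have muK : mu K = 0%E by rewrite (muE K mK) nuK sigmaK adde0.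
have dens' B : measurable B -> B `<=` K -> (eta%:E * lam B <= mu_q B)%E.
  by move=> mB BK; apply: (le_trans (dens B mB BK)); exact: ac_part_le.
by move: K0; rewrite (boolean_power_null q0 eta0 pow cK muK dens') ltxx.
Qed.

Lemma measure_support_dominates nu1 nu2 : nu1 `<< nu2 ->
  measure_support nu1 `<=` measure_support nu2.
Proof.
move=> nu12 x nu1x U xU; have := nu1x U xU.
have mU : measurable (U : set (measurableTypeR R)).
  by apply: open_measurable; case: xU.
rewrite !lt_neqAle !measure_ge0 !andbT; apply: contra => /eqP nu2U; apply/eqP.
by apply/esym; apply: (nu12 U) => //; apply/(measure0_null_setP _ mU).
Qed.

(** The relation is symmetric, [mu] being the Boolean power of [mu_q] of exponent
    [1 / q], so domination holds in both directions. *)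
Lemma boolean_power_support (q : R) mu mu_q nu nu_q : 0 < q ->
  is_boolean_power q mu mu_q -> is_ac_part mu nu -> is_ac_part mu_q nu_q ->
  measure_support nu_q = measure_support nu.
Proof.
move=> q0 pow acnu acnuq; apply/seteqP; split; apply: measure_support_dominates.
  exact: (ac_part_boolean_power q0 pow).
apply: (@ac_part_boolean_power q^-1 mu_q mu) => //; first by rewrite invr_gt0.
exact: boolean_power_inv.
Qed.

End absolute_continuity.

Unset Implicit Arguments.

Theorem corollary5p10 (R : realType) (mu : probability (measurableTypeR R) R)
    (mu_not_point : ~ point_mass mu) (Ind_mu : (0 < Ind mu)%E)
    (q : R) (q_gt0 : 0 < q)
    (mu_q : probability (measurableTypeR R) R)
    (mu_qE : is_boolean_power q mu mu_q)
    (mu_ac mu_q_ac : {measure set (measurableTypeR R) -> \bar R})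
    (mu_acE : is_ac_part mu mu_ac) (mu_q_acE : is_ac_part mu_q mu_q_ac) :
  number_of_components (measure_support mu_q_ac) =
  number_of_components (measure_support mu_ac).
Proof.
by rewrite (boolean_power_support q_gt0 mu_qE mu_acE mu_q_acE).
Qed.
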